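(* Let $\rho_1>0$, $\rho_2>0$ and $\beta>0$. Then the semigroup $(S(t))_{t\ge 0}$ generated by $\mathcal{A}$ on $\mathcal{H}$ is exponentially stable, i.e. there exist constants $C>0$ and $\alpha>0$ such that for every $U_0\in D(\mathcal{A})$, with $U(t):=S(t)U_0$ and $E(t):=\tfrac12\|U(t)\|_{\mathcal{H}}^2$ for $t\ge 0$, $$E(t)\le C e^{-\alpha t}E(0)\qquad\text{for all } t\ge 0.$$
   Context: Let $l_0<l_1<l_2<l_3$ be real numbers, $I_1=(l_0,l_1)$, $I_2=(l_1,l_2)$, $I_3=(l_2,l_3)$, and let $\rho_1,\rho_2,\beta\ge 0$ be constants. Function spaces are complex-valued; primes and $^{(k)}$ denote (weak) derivatives in $x$. Spaces: $H^2_{l_0}:=\{u\in H^2(I_1):u(l_0)=u'(l_0)=0\}$ with inner product $\langle u,\tilde u\rangle_{H^2_{l_0}}:=\langle u'',\tilde u''\rangle_{L^2(I_1)}$; $H^2_{l_3}:=\{w\in H^2(I_3):w(l_3)=w'(l_3)=0\}$ with $\langle w,\tilde w\rangle_{H^2_{l_3}}:=\langle w'',\tilde w''\rangle_{L^2(I_3)}$. $\mathbb{H}:=\{(u,v,w)\in H^2_{l_0}\times H^1(I_2)\times H^2_{l_3}: u(l_1)=v(l_1),\ v(l_2)=w(l_2)\}$ with inner product $\langle u,\tilde u\rangle_{H^2_{l_0}}+\langle v',\tilde v'\rangle_{L^2(I_2)}+\langle w,\tilde w\rangle_{H^2_{l_3}}$; $\mathbb{L}:=L^2(I_1)\times L^2(I_2)\times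 L^2(I_3)$ with the sum of the $L^2$ inner products. $\mathcal{H}:=\mathbb{H}\times\mathbb{L}$ with the sum inner product; it is a Hilbert space. Elements are written $U=(u_1,v_1,w_1,u_2,v_2,w_2)$ with $(u_1,v_1,w_1)\in\mathbb{H}$, $(u_2,v_2,w_2)\in\mathbb{L}$. Formal operator: $AU:=\big(u_2,\ v_2,\ w_2,\ -u_1^{(4)}+\rho_1u_2'',\ v_1''-\beta v_2,\ -w_1^{(4)}+\rho_2w_2''\big)$. For $U,\tilde U\in\mathbb{H}\times\mathbb{H}$ put $$a(U,\tilde U):=\langle u_2,\tilde u_1\rangle_{H^2_{l_0}}+\langle v_2',\tilde v_1'\rangle_{L^2(I_2)}+\langle w_2,\tilde w_1\rangle_{H^2_{l_3}}-\langle u_1'',\tilde u_2''\rangle_{L^2(I_1)}-\rho_1\langle u_2',\tilde u_2'\rangle_{L^2(I_1)}-\beta\langle v_2,\tilde v_2\rangle_{L^2(I_2)}-\langle v_1',\tilde v_2'\rangle_{L^2(I_2)}-\langle w_1'',\tilde w_2''\rangle_{L^2(I_3)}-\rho_2\langle w_2',\tilde w_2'\rangle_{L^2(I_3)}.$$ $U$ satisfies the transmission conditions in the weak sense if $\langle AU,\tilde U\rangle_{\mathcal{H}}=a(U,\tilde U)$ for all $\tilde U\in\mathbb{H}\times\mathbb{H}$. The operator $\mathcal{A}:D(\mathcal{A})\subset\mathcal{H}\to\mathcal{H}$ is $\mathcal{A}U:=AU$ with domain $D(\mathcal{A}):=\{U\in\mathbb{H}\times\mathbb{H}: u_1^{(4)}\in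 L^2(I_1),\ v_1''\in L^2(I_2),\ w_1^{(4)}\in L^2(I_3),\ U \text{ satisfies the transmission conditions in the weak sense}\}$. The operator $\mathcal{A}$ generates a $C_0$-semigroup of contractions on $\mathcal{H}$, denoted $(S(t))_{t\ge0}$. *)

(* Defs.v *)
From HB Require Import structures.
From mathcomp Require Import all_boot all_order all_algebra.
From mathcomp Require Import all_classical all_reals all_analysis.
From mathcomp Require Import complex.

Set Implicit Arguments.
Unset Strict Implicit.
Unset Printing Implicit Defensive.

Import Order.TTheory GRing.Theory Num.Theory.
Import numFieldNormedType.Exports.

Local Open Scope classical_set_scope.
Local Open Scope ring_scope.
Local Open Scope complex_scope.

(* Elements of the complex spaces L^2, H^1, H^2 over an interval ]a, b[ are
   represented by functions R -> R[i]; their values outside ]a, b[, or on a null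
   subset of it, are irrelevant: every notion below is invariant under equality
   almost everywhere on ]a, b[. *)
Section SobolevInterval.
Context {R : realType}.
Notation mu := (@lebesgue_measure R).
Implicit Types (a b : R) (f g u : R -> R[i]).

Definition Cintegral a b f : R[i] :=
  (\int[mu]_(x in `]a, b[) complex.Re (f x)) +i*
  (\int[mu]_(x in `]a, b[) complex.Im (f x)).

Definition L2 a b : set (R -> R[i]) := [set f : R -> R[i] |
  [/\ measurable_fun `]a, b[ (fun x => complex.Re (f x)),
      measurable_fun `]a, b[ (fun x => complex.Im (f x)) &
      mu.-integrable `]a, b[ (fun x => (Normc.normc (f x) ^+ 2)%:E)]].

Definition L2dot a b f g : R[i] := Cintegral a b (fun x => f x * (g x)^*).

Definition test_function a b (phi : R -> R) : Prop :=
  (forall n x, derivable (derive1n n phi) x 1) /\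
  (exists c d, [/\ a < c, c <= d, d < b &
     forall x, x \notin `[c, d] -> phi x = 0]).

(* [g] is the weak derivative of order [k] of [u] on ]a, b[, and is in L^2. *)
Definition is_wderiv a b (k : nat) u g : Prop :=
  L2 a b g /\
  forall phi, test_function a b phi ->
    Cintegral a b (fun x => u x * (derive1n k phi x)%:C) =
    (-1) ^+ k * Cintegral a b (fun x => g x * (phi x)%:C).

Definition has_wderiv a b k u : Prop := exists g, is_wderiv a b k u g.

(* A representative of the weak derivative (0 if there is none in L^2). *)
Definition wderiv a b k u : R -> R[i] := xget 0 [set g | is_wderiv a b k u g].

Definition Sobolev a b (m : nat) : set (R -> R[i]) := [set u : R -> R[i] |
  L2 a b u /\ forall k, (0 < k <= m)%N -> has_wderiv a b k u].

(* [g] is the representative of [u] that is continuous on [a, b]. *)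
Definition is_crepr a b u g : Prop :=
  [/\ {within `[a, b], continuous (fun x => complex.Re (g x))},
      {within `[a, b], continuous (fun x => complex.Im (g x))} &
      {ae mu, forall x, x \in `]a, b[ -> u x = g x}].

(* Pointwise value at [x] in [a, b] of a Sobolev function. *)
Definition trace a b u (x : R) : R[i] := xget 0 [set g | is_crepr a b u g] x.

Definition H2dot a b u v : R[i] := L2dot a b (wderiv a b 2 u) (wderiv a b 2 v).

(* The subspace of H^2(]a, b[) of functions clamped at the end point [c]. *)
Definition H2clamped a b (c : R) : set (R -> R[i]) := [set u : R -> R[i] |
  [/\ Sobolev a b 2 u, trace a b u c = 0 & trace a b (wderiv a b 1 u) c = 0]].

End SobolevInterval.

(* Operator semigroups on the space [X] with norm [N]. Vectors of [X] at
   distance 0 represent the same element, so identities are stated as the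
   vanishing of [N] on a difference. *)
Section Semigroup.
Context {R : realType} {V : lmodType R[i]}.
Variables (X : set V) (N : V -> R) (S : R -> V -> V).

Record C0_contraction_semigroup : Prop := {
  sg_stable : forall t U, 0 <= t -> X U -> X (S t U) ;
  sg_linear : forall t (c : R[i]) U W, 0 <= t -> X U -> X W ->
    N (S t (c *: U + W) - (c *: S t U + S t W)) = 0 ;
  sg_zero : forall U, X U -> N (S 0 U - U) = 0 ;
  sg_add : forall s t U, 0 <= s -> 0 <= t -> X U ->
    N (S (s + t) U - S s (S t U)) = 0 ;
  sg_continuous : forall U, X U -> N (S h U - U) @[h --> 0^'+] --> (0 : R) ;
  sg_contraction : forall t U, 0 <= t -> X U -> N (S t U) <= N U
}.

Definition has_sg_derivative (U F : V) : Prop :=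
  N ((h^-1)%:C *: (S h U - U) - F) @[h --> 0^'+] --> (0 : R).

Definition is_generator (D : set V) (A : V -> V) : Prop :=
  D = [set U | X U /\ exists2 F, X F & has_sg_derivative U F] /\
  forall U, D U -> X (A U) /\ has_sg_derivative U (A U).

End Semigroup.

Notation triple R := ((R -> R[i]) * (R -> R[i]) * (R -> R[i]))%type.
Notation state R := (triple R * triple R)%type.

(* The spaces written with blackboard bold H and L are [bH] and [bL]; the phase
   space, written with a calligraphic H, is [cH]. *)
Section PlateWavePlate.
Context {R : realType}.
Variables (l0 l1 l2 l3 rho1 rho2 beta : R).

Definition bH : set (triple R) := [set p : triple R | let: (u, v, w) := p in
  [/\ H2clamped l0 l1 l0 u, Sobolev l1 l2 1 v, H2clamped l2 l3 l3 w,
      trace l0 l1 u l1 = trace l1 l2 v l1 &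
      trace l1 l2 v l2 = trace l2 l3 w l2]].

Definition bHdot (p q : triple R) : R[i] :=
  let: (u, v, w) := p in let: (u', v', w') := q in
  H2dot l0 l1 u u' +
  L2dot l1 l2 (wderiv l1 l2 1 v) (wderiv l1 l2 1 v') +
  H2dot l2 l3 w w'.

Definition bL : set (triple R) := [set p : triple R | let: (u, v, w) := p in
  [/\ L2 l0 l1 u, L2 l1 l2 v & L2 l2 l3 w]].

Definition bLdot (p q : triple R) : R[i] :=
  let: (u, v, w) := p in let: (u', v', w') := q in
  L2dot l0 l1 u u' + L2dot l1 l2 v v' + L2dot l2 l3 w w'.

Definition cH : set (state R) := [set U : state R | bH U.1 /\ bL U.2].

Definition cHdot (U W : state R) : R[i] := bHdot U.1 W.1 + bLdot U.2 W.2.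

(* On [cH], the norm of a difference vanishes exactly when the two states agree
   componentwise almost everywhere. *)
Definition cHnorm (U : state R) : R := Num.sqrt (complex.Re (cHdot U U)).

Definition opA (U : state R) : state R :=
  let: ((u1, v1, w1), (u2, v2, w2)) := U in
  ((u2, v2, w2),
   (- wderiv l0 l1 4 u1 + rho1%:C *: wderiv l0 l1 2 u2,
    wderiv l1 l2 2 v1 - beta%:C *: v2,
    - wderiv l2 l3 4 w1 + rho2%:C *: wderiv l2 l3 2 w2)).

Definition forma (U W : state R) : R[i] :=
  let: ((u1, v1, w1), (u2, v2, w2)) := U in
  let: ((u1', v1', w1'), (u2', v2', w2')) := W in
  let d1 := wderiv l0 l1 1 in
  let d2 := wderiv l1 l2 1 in
  let d3 := wderiv l2 l3 1 in
  H2dot l0 l1 u2 u1' + L2dot l1 l2 (d2 v2) (d2 v1') + H2dot l2 l3 w2 w1'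
  - H2dot l0 l1 u1 u2' - rho1%:C * L2dot l0 l1 (d1 u2) (d1 u2')
  - beta%:C * L2dot l1 l2 v2 v2' - L2dot l1 l2 (d2 v1) (d2 v2')
  - H2dot l2 l3 w1 w2' - rho2%:C * L2dot l2 l3 (d3 w2) (d3 w2').

Definition weak_transmission (U : state R) : Prop :=
  forall W, bH W.1 -> bH W.2 -> cHdot (opA U) W = forma U W.

Definition domA : set (state R) := [set U : state R |
  [/\ bH U.1, bH U.2,
      let: (u1, v1, w1) := U.1 in
      [/\ has_wderiv l0 l1 4 u1, has_wderiv l1 l2 2 v1 & has_wderiv l2 l3 4 w1] &
      weak_transmission U]].

Definition energy (U : state R) : R := 2^-1 * cHnorm U ^+ 2.

End PlateWavePlate.

(* Main.v *)
Require Import Defs.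
From mathcomp Require Import all_boot all_order all_algebra.
From mathcomp Require Import all_classical all_reals all_analysis.
From mathcomp Require Import measurable_realfun complex ring lra.

(** The system is a damped second-order equation [p'' + K p + Q p' = 0] for the
    displacement [p = (u, v, w)], where [K] is the elastic operator and
    [Q p' = (- rho1 u_t'', beta v_t, - rho2 w_t'')]. Each piece of the structure
    is damped: by Poincaré's inequality, applied to the plates clamped at [l0]
    and [l3], the dissipation [Q (p', p')] dominates the whole kinetic energy.
    Nothing has to be propagated from one part to another, and a multiplier
    argument in the time domain applies. Testing the weak transmission conditions
    with [(p, p')] gives [d/dt E = - Q (p', p')]; testing them with [(0, p)] gives
    [d/dt Re <p', p> = |p'|^2 - |p|_H^2 - Re Q (p', p)]. Poincaré's inequality
    also bounds [Q (p, p)] by [|p|_H^2]: the middle component [v] has no clamped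
    end, but its trace at [l1] is that of [u]. Hence for small [e > 0] the
    functional [E + e Re <p', p>] is equivalent to [E] and decreases exponentially
    ([damped_exponential_decay]).

    Two bodies of theory support this. The first one is abstract: vectors of the
    phase space are functions, equal when they agree almost everywhere, so the
    forms are semi-inner products on a subspace ([semi_inner]) and the semigroup
    laws hold up to null vectors. Orbits of domain points stay in the domain, are
    differentiable from the right and continuous, which is enough to integrate
    the differential inequality ([right_dini_le0_nonincr],
    [lyapunov_exponential_decay]).

    The second one is the theory of Sobolev functions of one variable. Cutoff
    functions built from [exp (- 1/x)] give the fundamental lemma of the calculus
    of variations ([ae0_of_test]), hence uniqueness of weak derivatives; a
    function with a weak derivative is a primitive of it
    ([weak_derivative_primitive]), hence has a continuous representative, so that
    traces are defined and linear and Poincaré's inequality follows from the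
    Cauchy-Schwarz inequality ([poincare_trace]). *)

Set Implicit Arguments.
Unset Strict Implicit.
Unset Printing Implicit Defensive.

Import Order.TTheory GRing.Theory Num.Theory.
Import numFieldNormedType.Exports.
Local Open Scope classical_set_scope.
Local Open Scope ring_scope.

(** * Monotonicity from right Dini derivatives *)

Section DiniMonotone.
Context {R : realType}.
Implicit Type f : R -> R.

(** The points up to which [f] stays below the line [f 0 + e * r] form an interval,
    closed by the left condition and open to the right by the Dini condition. *)
Lemma right_dini_le0_nonincr f :
  (forall t e, 0 <= t -> 0 < e ->
    \forall h \near (0 : R)^'+, f (t + h) <= f t + e * h) ->
  (forall t e, 0 < t -> 0 < e ->
    \forall h \near (0 : R)^'+, f t <= f (t - h) + e) ->
  forall t, 0 <= t -> f t <= f 0.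
Proof.
move=> fr fl T T0; apply/ler_addgt0Pr => e0 e0_gt0.
pose e := e0 / (T + 1).
have e_gt0 : 0 < e by rewrite divr_gt0// ltr_wpDl.
suff : f T <= f 0 + e * T.
  move=> /le_trans; apply; rewrite lerD2l /e mulrAC ler_pdivrMr ?ltr_wpDl//.
  by rewrite ler_pM2l// lerDl.
pose A := [set s | 0 <= s <= T /\ forall r, 0 <= r <= s -> f r <= f 0 + e * r].
have A0 : A 0.
  split; first by rewrite lexx.
  by move=> r; rewrite -eq_le => /eqP <-; rewrite mulr0 addr0.
have Aub : ubound A T by move=> s [/andP[_ ->]].
have supA : has_sup A by split; [exists 0|exists T].
set s := sup A.
have s0 : 0 <= s by apply: ub_le_sup => //; exists T.
have sT : s <= T by apply: ge_sup => //; exists 0.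
have Alt r : 0 <= r -> r < s -> f r <= f 0 + e * r.
  move=> r0; rewrite -subr_gt0 => rs; have [r' Ar' rr'] := sup_adherent rs supA.
  by apply: Ar'.2; rewrite r0/= ltW//; move: rr'; rewrite -/s opprB addrC subrK.
have fs : f s <= f 0 + e * s.
  move: (s0); rewrite le_eqVlt => /predU1P[<-|s_gt0]; first by rewrite mulr0 addr0.
  apply/ler_addgt0Pr => d d_gt0.
  have : \forall h \near (0 : R)^'+, f s <= f 0 + e * s + d.
    near=> h.
    have h0 : 0 < h by near: h; exact: nbhs_right_gt.
    have hs : h < s by near: h; exact: nbhs_right_lt.
    have : f s <= f (s - h) + d by near: h; exact: fl.
    move=> /le_trans; apply; rewrite lerD2r.
    have := Alt (s - h); rewrite subr_ge0 ltW// => /(_ isT).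
    rewrite ltrBlDr ltrDl => /(_ h0) /le_trans; apply.
    by rewrite lerD2l ler_pM2l// gerBl ltW.
  by move=> H; near (0 : R)^'+ => h; near: h; exact: H.
move: sT; rewrite le_eqVlt => /predU1P[<-//|sT].
have : \forall h \near (0 : R)^'+, False.
  have := fr s e s0 e_gt0.
  move=> [d /= d_gt0 Hd].
  pose h := Num.min (d / 2) (T - s).
  have h_gt0 : 0 < h by rewrite lt_min divr_gt0//= subr_gt0.
  have : A (s + h).
    split; first by rewrite addr_ge0 ?(ltW h_gt0)//= -lerBrDl ge_min lexx orbT.
    move=> r /andP[r0 rsh]; have [rs|sr] := ltP r s; first exact: Alt.
    move: (sr); rewrite le_eqVlt => /predU1P[<-//|{}sr].
    have := Hd (r - s); rewrite /ball_/= sub0r normrN gtr0_norm ?subr_gt0//.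
    rewrite [s + _]addrC subrK; move=> /(_ _ sr).
    move=> H; apply: le_trans (H _) _.
      rewrite (@le_lt_trans _ _ h)// ?lerBlDl//.
      by rewrite gt_min; apply/orP; left; rewrite ltr_pdivrMr// ltr_pMr// ltr1n.
    by rewrite mulrBr; lra.
  move=> /(ub_le_sup (ex_intro _ T Aub)); rewrite -/s gerDl leNgt h_gt0.
  by [].
by move=> H; exfalso; near (0 : R)^'+ => h; near: h; exact: H.
Unshelve. all: by end_near. Qed.

End DiniMonotone.

(** * Semi-inner products *)

Section SemiInnerProduct.
Context {R : realType} {V : lmodType R[i]}.
Implicit Types (X : set V) (B : V -> V -> R).
Local Open Scope complex_scope.

Definition real_subspace X :=
  X 0 /\ forall (c : R) x y, X x -> X y -> X (c%:C *: x + y).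

(** Weak derivatives and traces are chosen representatives, linear only almost
    everywhere and only where they exist: hence forms that are bilinear on a
    subspace and not definite. Real scalars suffice for energy estimates. *)
Definition semi_inner X B := [/\
  forall (c : R) x y z, X x -> X y -> X z ->
    B (c%:C *: x + y) z = c * B x z + B y z,
  forall x y, X x -> X y -> B x y = B y x &
  forall x, X x -> 0 <= B x x].

Variables (X : set V) (hX : real_subspace X).

Lemma subspaceD x y : X x -> X y -> X (x + y).
Proof. by move=> Xx Xy; have := hX.2 1 _ _ Xx Xy; rewrite scale1r. Qed.

Lemma subspaceZ (c : R) x : X x -> X (c%:C *: x).
Proof. by move=> Xx; have := hX.2 c _ _ Xx hX.1; rewrite addr0. Qed.

Lemma subspaceB x y : X x -> X y -> X (x - y).
Proof.
move=> Xx Xy; have := hX.2 (- 1) _ _ Xy Xx.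
by rewrite rmorphN/= scaleN1r addrC.
Qed.

Variables (B : V -> V -> R) (hB : semi_inner X B).

Lemma semi_innerDl x y z : X x -> X y -> X z -> B (x + y) z = B x z + B y z.
Proof.
case: hB => lB _ _ Xx Xy Xz.
by have := lB 1 x y z Xx Xy Xz; rewrite scale1r mul1r.
Qed.

Lemma semi_inner0l z : X z -> B 0 z = 0.
Proof.
move=> Xz; have := semi_innerDl hX.1 hX.1 Xz.
by rewrite addr0 => /esym/eqP; rewrite addrC -subr_eq0 addrK => /eqP.
Qed.

Lemma semi_innerZl (c : R) x z : X x -> X z -> B (c%:C *: x) z = c * B x z.
Proof.
case: hB => lB _ _ Xx Xz.
by have := lB c x 0 z Xx hX.1 Xz; rewrite addr0 semi_inner0l// addr0.
Qed.

Lemma semi_innerC x y : X x -> X y -> B x y = B y x.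
Proof. by case: hB => _ sB _; exact: sB. Qed.

Lemma semi_inner_ge0 x : X x -> 0 <= B x x.
Proof. by case: hB => _ _; exact. Qed.

Lemma semi_inner0r z : X z -> B z 0 = 0.
Proof. by move=> Xz; rewrite semi_innerC// ?semi_inner0l//; exact: hX.1. Qed.

Lemma semi_inner_sqrD (c : R) x y : X x -> X y ->
  B (x + c%:C *: y) (x + c%:C *: y) = B x x + 2 * c * B x y + c ^+ 2 * B y y.
Proof.
move=> Xx Xy; have Xcy := subspaceZ c Xy.
have Xs := subspaceD Xx Xcy.
rewrite semi_innerDl// semi_innerZl// [B x _]semi_innerC// [B y _]semi_innerC//.
rewrite !semi_innerDl// !semi_innerZl// (semi_innerC Xy Xx).
by ring.
Qed.

Lemma semi_inner_cauchy_schwarz x y : X x -> X y -> B x y ^+ 2 <= B x x * B y y.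
Proof.
move=> Xx Xy; have Q c : 0 <= B x x + 2 * c * B x y + c ^+ 2 * B y y.
  rewrite -semi_inner_sqrD//; apply: semi_inner_ge0.
  by apply: subspaceD => //; exact: subspaceZ.
(* If [B y y = 0] the quadratic polynomial is affine, and takes negative values
   unless its slope vanishes. *)
have := semi_inner_ge0 Xy; rewrite le_eqVlt => /predU1P[y0|y_gt0].
  have [->|xy0] := eqVneq (B x y) 0.
    by rewrite expr0n/= -y0 mulr0.
  exfalso; have := Q (- (B x x + 1) / (2 * B x y)).
  rewrite -y0 mulr0 addr0.
  have -> : 2 * (- (B x x + 1) / (2 * B x y)) * B x y = - (B x x + 1).
    by field.
  by lra.
have := Q (- B x y / B y y).
have -> : B x x + 2 * (- B x y / B y y) * B x y + (- B x y / B y y) ^+ 2 * B y y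
   = B x x - B x y ^+ 2 / B y y by field; rewrite gt_eqF.
by rewrite subr_ge0 ler_pdivrMr.
Qed.

Lemma semi_inner_young s x y : 0 < s -> X x -> X y ->
  `|2 * B x y| <= s * B x x + s^-1 * B y y.
Proof.
move=> s0 Xx Xy.
have Q c : 0 <= B x x + 2 * c * B x y + c ^+ 2 * B y y.
  rewrite -semi_inner_sqrD//; apply: semi_inner_ge0.
  by apply: subspaceD => //; exact: subspaceZ.
rewrite ler_norml; apply/andP; split.
- have := Q s^-1; rewrite -(pmulr_rge0 _ s0) => {}Q.
  rewrite -subr_ge0; move: Q; congr (0 <= _); field; lra.
- have := Q (- s^-1); rewrite -(pmulr_rge0 _ s0) => {}Q.
  rewrite -subr_ge0; move: Q; congr (0 <= _); field; lra.
Qed.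

Lemma semi_inner_sqr_le x y : X x -> X y ->
  B (x + y) (x + y) <= 2 * (B x x + B y y).
Proof.
move=> Xx Xy; have := @semi_inner_sqrD 1 _ _ Xx Xy; rewrite scale1r => ->.
have := @semi_inner_young 1 _ _ ltr01 Xx Xy.
by rewrite invr1 ler_norml => /andP[_]; lra.
Qed.

(** By the Cauchy-Schwarz inequality a null vector is orthogonal to everything, so
    [B] descends to the quotient by null vectors. *)
Lemma semi_inner_null x y : X x -> X y -> B (x - y) (x - y) = 0 ->
  forall z, X z -> B x z = B y z.
Proof.
move=> Xx Xy xy0 z Xz; have Xxy := subspaceB Xx Xy.
have := semi_inner_cauchy_schwarz Xxy Xz; rewrite xy0 mul0r.
rewrite le_eqVlt ltNge sqr_ge0 orbF sqrf_eq0 => /eqP xyz0.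
rewrite -[in LHS](subrK y x) semi_innerDl// xyz0 add0r//.
Qed.

Lemma semi_inner_null_sqr x y : X x -> X y -> B (x - y) (x - y) = 0 ->
  B x x = B y y.
Proof.
move=> Xx Xy xy0; have e := semi_inner_null Xx Xy xy0.
by rewrite e// semi_innerC// e.
Qed.

End SemiInnerProduct.

(** * Lyapunov functionals for contraction semigroups *)

Section ModuleIdentities.
Context {K : fieldType} {V : lmodType K}.
Implicit Types (c : K) (a b d e f g z : V).

Lemma subr_telescope a b z : a - b = z - b - (z - a).
Proof. by rewrite opprB [RHS]addrC addrA subrK. Qed.

Lemma diff_quotientE c c' a b d e f g : c' * c = 1 ->
  c' *: (a - d) - f - g = c' *: (a - b + (b - (c *: e + d))) + (e - (g + f)).
Proof.
move=> cK; rewrite [a - b + _]addrA subrK [c *: e + d]addrC opprD.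
rewrite [a + (_ - _)]addrA [X in _ = X + _]scalerBr scalerA cK scale1r.
by rewrite [RHS]addrA subrK [g + f]addrC opprD addrA.
Qed.

End ModuleIdentities.

Section Lyapunov.
Context {R : realType} {V : lmodType R[i]}.
Local Open Scope complex_scope.
Variables (X D : set V) (B : V -> V -> R) (S : R -> V -> V) (A : V -> V).
Hypotheses (hX : real_subspace X) (hB : semi_inner X B).
Let N (x : V) := Num.sqrt (B x x).
Hypotheses (hS : C0_contraction_semigroup X N S) (hA : is_generator X N S D A).

Let null : set V := [set x | X x /\ B x x = 0].

Let null_subspace : real_subspace null.
Proof.
split; first by split; [exact: hX.1|exact: (semi_inner0l hX hB hX.1)].
move=> c x y [Xx x0] [Xy y0]; split; first exact: hX.2.
rewrite addrC (semi_inner_sqrD hX hB)// x0 y0 mulr0 addr0 add0r.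
have := semi_inner_cauchy_schwarz hX hB Xy Xx.
rewrite y0 mul0r le_eqVlt ltNge sqr_ge0 orbF sqrf_eq0 => /eqP ->.
by rewrite mulr0.
Qed.

Let nullP x : X x -> N x = 0 -> null x.
Proof.
move=> Xx /eqP; rewrite sqrtr_eq0 => x0; split => //.
by apply/eqP; rewrite eq_le x0 (semi_inner_ge0 hB).
Qed.

Let null_N x y : X x -> X y -> null (x - y) -> N x = N y.
Proof.
by move=> Xx Xy [_ xy0]; rewrite /N (semi_inner_null_sqr hX hB Xx Xy).
Qed.

Let domX U : D U -> X U.
Proof. by move: hA.1 => -> []. Qed.

(** The difference quotient of the orbit at time [t] is the image by [S t] of the
    one at time 0, up to null vectors, and [S t] is a contraction. *)
Lemma generator_domain_invariant U t : D U -> 0 <= t -> D (S t U).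
Proof.
move=> DU t0; have XU := domX DU; have [XAU dU] := hA.2 _ DU.
rewrite hA.1; split; first exact: (sg_stable hS).
exists (S t (A U)); first exact: (sg_stable hS).
rewrite /has_sg_derivative.
apply: (@squeeze_cvgr _ _ _ _ (fun=> 0)
  (fun h => N (h^-1%:C *: (S h U - U) - A U))); [|exact: cvg_cst|exact: dU].
near=> h; rewrite sqrtr_ge0/=.
have h0 : 0 < h by near: h; exact: nbhs_right_gt.
have h_ge0 := ltW h0.
have st s x : 0 <= s -> X x -> X (S s x) by exact: (sg_stable hS).
set y := h^-1%:C *: (S h U - U) - A U.
have Xy : X y.
  by apply: (subspaceB hX) => //; apply: (subspaceZ hX); apply: (subspaceB hX)=> //; exact: st.
have XyA : X (y + A U) by exact: (subspaceD hX).
have hU : S h U = h%:C *: (y + A U) + U.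
  by rewrite /y subrK scalerA -rmorphM/= divff ?gt_eqF// scale1r subrK.
(* [e0], [e1] and [e2] are the defects of commutation of [S h] with [S t] and of
   linearity of [S t]. *)
pose e1 := S t (S h U) - (h%:C *: S t (y + A U) + S t U).
pose e2 := S t (y + A U) - (S t y + S t (A U)).
pose e0 := S h (S t U) - S t (S h U).
have ne1 : null e1.
  apply: nullP; last by rewrite /e1 hU; exact: (sg_linear hS).
  apply: (subspaceB hX); first by apply: (st) => //; exact: st.
  by apply: hX.2; exact: st.
have ne2 : null e2.
  apply: nullP.
    by apply: (subspaceB hX); [exact: st|apply: (subspaceD hX); exact: st].
  by have := sg_linear hS 1 t0 Xy XAU; rewrite !scale1r.
have ne0 : null e0.
  have n1 : null (S (t + h) U - S t (S h U)).
    apply: nullP; last exact: (sg_add hS).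
    by apply: (subspaceB hX); [apply: (st) => //; exact: addr_ge0|do 2 apply: (st) => //].
  have n2 : null (S (h + t) U - S h (S t U)).
    apply: nullP; last exact: (sg_add hS).
    by apply: (subspaceB hX); [apply: (st) => //; exact: addr_ge0|do 2 apply: (st) => //].
  have -> : e0 = S (t + h) U - S t (S h U) - (S (h + t) U - S h (S t U)).
    by rewrite [h + t]addrC; exact: subr_telescope.
  exact: subspaceB.
have Ee : h^-1%:C *: (S h (S t U) - S t U) - S t (A U) - S t y =
    h^-1%:C *: (e0 + e1) + e2.
  by apply: diff_quotientE; rewrite -rmorphM/= mulVf ?gt_eqF.
have XStU : X (h^-1%:C *: (S h (S t U) - S t U) - S t (A U)).
  apply: (subspaceB hX); last exact: st.
  by apply: (subspaceZ hX); apply: (subspaceB hX); do ? apply: (st) => //.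
apply: (@le_trans _ _ (N (S t y))); last exact: (sg_contraction hS).
rewrite -/(N _) (null_N XStU (st _ _ t0 Xy))// Ee.
by apply: null_subspace.2 => //; exact: (subspaceD null_subspace).
Unshelve. all: by end_near. Qed.

Variables (P : V -> V -> R) (m M k : R).
Hypotheses (hP : semi_inner X P)
  (mP : forall x, X x -> m * B x x <= P x x)
  (PM : forall x, X x -> P x x <= M * B x x)
  (k_ge0 : 0 <= k)
  (diss : forall U, D U -> 2 * P (A U) U <= - k * P U U).

Let P_N x : X x -> P x x <= `|M| * N x ^+ 2.
Proof.
move=> Xx; have B0 := semi_inner_ge0 hB Xx.
rewrite sqr_sqrtr// (le_trans (PM Xx))// ler_wpM2r//.
exact: ler_norm.
Qed.

Let P_null x y : X x -> X y -> N (x - y) = 0 -> P x x = P y y.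
Proof.
move=> Xx Xy xy0; apply: (semi_inner_null_sqr hX hP) => //.
have Xxy := subspaceB hX Xx Xy.
apply/eqP; rewrite eq_le (semi_inner_ge0 hP)// andbT.
by rewrite (le_trans (P_N Xxy))// xy0 expr0n mulr0.
Qed.

Let p U t := P (S t U) (S t U).

(** With [y = S t U], expand the quadratic form at
    [S h y = y + h (A y + r h)], where [N (r h)] tends to 0. *)
Let p_right U t e : D U -> 0 <= t -> 0 < e ->
  \forall h \near (0 : R)^'+, p U (t + h) <= p U t * (1 - k * h) + e * h.
Proof.
move=> DU t0 e0; set y := S t U.
have Dy : D y by exact: generator_domain_invariant.
have Xy := domX Dy; have [XAy dy] := hA.2 _ Dy.
pose r h := h^-1%:C *: (S h y - y) - A y.
have rcvg : N (r h) @[h --> (0 : R)^'+] --> (0 : R) by exact: dy.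
have P0 := semi_inner_ge0 hP.
pose K := Num.sqrt `|M| * Num.sqrt (P y y).
pose E h := 2 * (N (r h) * K) + h * (2 * (P (A y) (A y) + `|M| * N (r h) ^+ 2)).
have Ecvg : E h @[h --> (0 : R)^'+] --> (0 : R).
  have idc : (h : R) @[h --> (0 : R)^'+] --> (0 : R).
    by apply: cvg_at_right_filter; exact: cvg_id.
  rewrite [X in _ --> X](_ : _ = 2 * (0 * K) +
      0 * (2 * (P (A y) (A y) + `|M| * 0 ^+ 2))); last first.
    by rewrite !mul0r mulr0 addr0.
  apply: cvgD; first by apply: cvgM; [exact: cvg_cst|apply: cvgM=> //; exact: cvg_cst].
  apply: cvgM => //; apply: cvgM; first exact: cvg_cst.
  apply: cvgD; first exact: cvg_cst.
  by apply: cvgM; [exact: cvg_cst|rewrite expr2; apply: cvgM].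
have Ee : \forall h \near (0 : R)^'+, E h < e by exact: (cvgr_lt _ Ecvg).
near=> h.
have h0 : 0 < h by near: h; exact: nbhs_right_gt.
have h_ge0 := ltW h0.
have Ehe : E h < e by near: h; exact: Ee.
have st s x : 0 <= s -> X x -> X (S s x) by exact: (sg_stable hS).
have XU := domX DU.
have Xr : X (r h).
  by apply: (subspaceB hX) => //; apply: (subspaceZ hX); apply: (subspaceB hX) => //; exact: st.
have XAr : X (A y + r h) by exact: (subspaceD hX).
have Shy : S h y = y + h%:C *: (A y + r h).
  rewrite /r [A y + _]addrC subrK scalerA -rmorphM/= divff ?gt_eqF// scale1r.
  by rewrite addrC subrK.
have -> : p U (t + h) = P (S h y) (S h y).
  rewrite /p addrC; apply: P_null; [by apply: (st) => //; exact: addr_ge0|exact: st|].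
  exact: (sg_add hS).
rewrite Shy (semi_inner_sqrD hX hP)//.
have PrK : P (r h) y <= N (r h) * K.
  rewrite (le_trans (ler_norm _))// -(@ler_pXn2r _ 2)// ?nnegrE//; last first.
    by rewrite !mulr_ge0// sqrtr_ge0.
  rewrite real_normK ?num_real//.
  rewrite (le_trans (semi_inner_cauchy_schwarz hX hP Xr Xy))//.
  rewrite !exprMn [Num.sqrt `|M| ^+ 2]sqr_sqrtr// [Num.sqrt (P y y) ^+ 2]sqr_sqrtr; last exact: P0.
  rewrite mulrA ler_wpM2r//; first exact: P0.
  by rewrite mulrC P_N.
have PAr : P (A y + r h) (A y + r h) <= 2 * (P (A y) (A y) + `|M| * N (r h) ^+ 2).
  rewrite (le_trans (semi_inner_sqr_le hX hP XAy Xr))// ler_pM2l// lerD2l.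
  exact: P_N.
have PyA : P y (A y + r h) = P (A y) y + P (r h) y.
  by rewrite (semi_innerC hP)// (semi_innerDl hP).
have dP := diss Dy.
rewrite PyA -/y.
have -> : p U t = P y y by [].
have hd : h * (2 * P (A y) y) <= h * (- k * P y y) by rewrite ler_pM2l.
have hr : h * (2 * P (r h) y + h * P (A y + r h) (A y + r h)) <= h * e.
  rewrite ler_pM2l// (le_trans _ (ltW Ehe))// /E lerD//.
    by rewrite ler_pM2l.
  by rewrite ler_pM2l.
nra.
Unshelve. all: by end_near. Qed.

(** Left continuity comes from contractivity: [S t U] and [S (t - h) U] are no
    farther apart than [S h U] and [U]. *)
Let p_left U t e : D U -> 0 < t -> 0 < e ->
  \forall h \near (0 : R)^'+, p U t <= p U (t - h) + e.
Proof.
move=> DU t0 e0; have XU := domX DU.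
have P0 := semi_inner_ge0 hP.
have st s x : 0 <= s -> X x -> X (S s x) by exact: (sg_stable hS).
pose q h := N (S h U - U).
have qcvg : q h @[h --> (0 : R)^'+] --> (0 : R) by exact: (sg_continuous hS).
pose E h := 2 * (`|M| * q h * N U) + `|M| * q h ^+ 2.
have Ecvg : E h @[h --> (0 : R)^'+] --> (0 : R).
  rewrite [X in _ --> X](_ : _ = 2 * (`|M| * 0 * N U) + `|M| * 0 ^+ 2); last first.
    by rewrite expr0n/= !(mulr0, mul0r) addr0.
  apply: cvgD.
    apply: cvgM; first exact: cvg_cst.
    apply: cvgM; last exact: cvg_cst.
    by apply: cvgM => //; exact: cvg_cst.
  by apply: cvgM; [exact: cvg_cst|rewrite expr2; exact: cvgM].
have Ee : \forall h \near (0 : R)^'+, E h < e by exact: (cvgr_lt _ Ecvg).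
near=> h.
have h0 : 0 < h by near: h; exact: nbhs_right_gt.
have h_ge0 := ltW h0.
have ht : h < t by near: h; exact: nbhs_right_lt.
have th0 : 0 <= t - h by rewrite subr_ge0 ltW.
have Ehe : E h < e by near: h; exact: Ee.
set y := S (t - h) U; have Xy : X y by exact: st.
have XShU : X (S h U) by exact: st.
have Xq : X (S h U - U) by exact: (subspaceB hX).
pose z := S (t - h) (S h U - U); have Xz : X z by exact: st.
have -> : p U t = P (y + z) (y + z).
  have -> : p U t = P (S (t - h) (S h U)) (S (t - h) (S h U)).
    rewrite /p -[t in LHS](subrK h).
    apply: P_null; [by rewrite subrK; apply: (st) => //; exact: ltW|by do 2 apply: (st) => //|].
    exact: (sg_add hS).
  have -> : S h U = 1 *: (S h U - U) + U by rewrite scale1r subrK.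
  have Xs : X (1 *: (S h U - U) + U) by rewrite scale1r; exact: (subspaceD hX).
  rewrite [y + z]addrC; apply: P_null; [exact: (st)|exact: (subspaceD hX)|].
  by have := sg_linear hS 1 th0 Xq XU; rewrite [1 *: S _ _]scale1r.
have Nz : N z <= q h by exact: (sg_contraction hS).
have Ny : N y <= N U by exact: (sg_contraction hS).
have N0 x : 0 <= N x by exact: sqrtr_ge0.
have Pz : P z z <= `|M| * q h ^+ 2.
  by rewrite (le_trans (P_N Xz))// ler_wpM2l// ler_pXn2r// nnegrE (le_trans (N0 z)).
have Pzy : P y z <= `|M| * q h * N U.
  rewrite (le_trans (ler_norm _))// -(@ler_pXn2r _ 2)// ?nnegrE//; last first.
    by rewrite !mulr_ge0// N0.
  rewrite real_normK ?num_real//.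
  rewrite (le_trans (semi_inner_cauchy_schwarz hX hP Xy Xz))//.
  rewrite mulrC; apply: (@le_trans _ _ ((`|M| * q h ^+ 2) * (`|M| * N y ^+ 2))).
    by apply: ler_pM; [exact: P0|exact: P0|exact: Pz|exact: P_N].
  rewrite [X in _ <= X](_ : _ = (`|M| * q h ^+ 2) * (`|M| * N U ^+ 2)); last by ring.
  apply: ler_wpM2l; first by rewrite mulr_ge0// sqr_ge0.
  by apply: ler_wpM2l => //; rewrite ler_pXn2r// nnegrE.
have := semi_inner_sqrD hX hP 1 Xy Xz; rewrite scale1r => ->.
rewrite /p -/y -addrA lerD2l (le_trans _ (ltW Ehe))// /E expr1n mulr1 mul1r.
by rewrite lerD// ler_pM2l.
Unshelve. all: by end_near. Qed.

(** The function [expR (k * s) * P (S s U) (S s U)] has nonpositive right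
    derivative, because the orbit of a point of the domain stays in the domain;
    being continuous, it does not increase. *)
Theorem lyapunov_exponential_decay U t : D U -> 0 <= t ->
  m * B (S t U) (S t U) <= expR (- (k * t)) * (M * B (S 0 U) (S 0 U)).
Proof.
move=> DU t0; have XU := domX DU.
have st s x : 0 <= s -> X x -> X (S s x) by exact: (sg_stable hS).
have p0 s : 0 <= s -> 0 <= p U s.
  by move=> s0; apply: (semi_inner_ge0 hP); exact: st.
suff H : expR (k * t) * p U t <= expR (k * 0) * p U 0.
  apply: (@le_trans _ _ (expR (- (k * t)) * p U 0)).
    rewrite (le_trans (mP (st _ _ t0 XU)))//.
    rewrite -(@ler_pM2l _ (expR (k * t))) ?expR_gt0// mulrA expRxMexpNx_1 mul1r.
    by rewrite (le_trans H)// mulr0 expR0 mul1r.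
  by rewrite ler_pM2l ?expR_gt0// PM//; exact: st.
apply: (@right_dini_le0_nonincr _ (fun s => expR (k * s) * p U s)) => // {t0 t}.
- move=> t e t0 e0.
  have e'0 : 0 < e / expR (k * (t + 1)) by rewrite divr_gt0 ?expR_gt0.
  near=> h.
  have h0 : 0 < h by near: h; exact: nbhs_right_gt.
  have h_ge0 := ltW h0.
  have h1 : h < 1 by near: h; exact: nbhs_right_lt.
  have hp : p U (t + h) <= p U t * (1 - k * h) + e / expR (k * (t + 1)) * h.
    by near: h; exact: p_right.
  apply: (@le_trans _ _ (expR (k * (t + h)) * (p U t * (1 - k * h)) +
     expR (k * (t + h)) * (e / expR (k * (t + 1)) * h))).
    by rewrite -mulrDr ler_pM2l ?expR_gt0.
  apply: lerD.
    rewrite mulrDr expRD -mulrA ler_pM2l ?expR_gt0//.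
    rewrite mulrCA ler_piMr ?p0//.
    rewrite -[leRHS](expRxMexpNx_1 (k * h)) ler_pM2l ?expR_gt0//.
    exact: expR_ge1Dx.
  rewrite mulrA ler_wpM2r// mulrCA ler_piMr ?(ltW e0)//.
  rewrite ler_pdivrMr ?expR_gt0// mul1r ler_expR ler_wpM2l// lerD2l.
  exact: ltW.
- move=> t e t0 e0.
  have e2 : 0 < e / 2 / expR (k * t) by rewrite !divr_gt0 ?expR_gt0.
  pose C := expR (k * t) * (`|M| * N U ^+ 2).
  have C0 : 0 <= C by rewrite mulr_ge0 ?expR_ge0// mulr_ge0// sqr_ge0.
  have ecvg : expR (k * h) @[h --> (0 : R)^'+] --> (1 : R).
    rewrite -expR0 -[X in _ --> expR X](mulr0 k).
    apply: cvg_at_right_filter.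
    apply: (@continuous_comp _ _ _ (fun h => k * h) expR).
      by apply: cvgM; [exact: cvg_cst|exact: cvg_id].
    exact: continuous_expR.
  have e3 : 0 < e / 2 / (C + 1) by rewrite !divr_gt0 ?ltr_wpDl.
  have ne : \forall h \near (0 : R)^'+, expR (k * h) < 1 + e / 2 / (C + 1).
    by apply: (cvgr_lt _ ecvg); rewrite ltrDl.
  near=> h.
  have h0 : 0 < h by near: h; exact: nbhs_right_gt.
  have h_ge0 := ltW h0.
  have ht : h < t by near: h; exact: nbhs_right_lt.
  have th0 : 0 <= t - h by rewrite subr_ge0 ltW.
  have hp : p U t <= p U (t - h) + e / 2 / expR (k * t) by near: h; exact: p_left.
  have he : expR (k * h) < 1 + e / 2 / (C + 1) by near: h; exact: ne.
  apply: (@le_trans _ _ (expR (k * t) * (p U (t - h) + e / 2 / expR (k * t)))).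
    by rewrite ler_pM2l ?expR_gt0.
  rewrite mulrDr [expR _ * (e / 2 / _)]mulrC mulfVK ?gt_eqF ?expR_gt0//.
  rewrite [X in _ <= _ + X](splitr e) addrA lerD2r.
  have -> : k * t = k * (t - h) + k * h by rewrite -mulrDr subrK.
  rewrite expRD -mulrA [expR (k * h) * _]mulrC mulrA.
  set q := expR (k * (t - h)) * p U (t - h).
  have q0 : 0 <= q by rewrite mulr_ge0 ?expR_ge0 ?p0.
  have qC : q <= C.
    rewrite /q /C ler_pM ?expR_ge0 ?p0//.
      by rewrite ler_expR ler_wpM2l// gerBl.
    rewrite (le_trans (P_N (st _ _ th0 XU)))// ler_wpM2l//.
    by rewrite ler_pXn2r// ?nnegrE ?sqrtr_ge0//; exact: (sg_contraction hS).
  apply: (@le_trans _ _ (q * (1 + e / 2 / (C + 1)))).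
    by rewrite ler_wpM2l// ltW.
  rewrite mulrDr mulr1 lerD2l mulrA ler_pdivrMr ?ltr_wpDl// mulrC ler_wpM2l//.
    by rewrite ltW// divr_gt0.
  by rewrite (le_trans qC)// lerDl.
Unshelve. all: by end_near. Qed.

End Lyapunov.

(** * Damped second-order systems *)

Section SemiInnerConstructions.
Context {R : realType}.
Local Open Scope complex_scope.

Lemma semi_innerS (V : lmodType R[i]) (X Y : set V) (B : V -> V -> R) :
  Y `<=` X -> semi_inner X B -> semi_inner Y B.
Proof.
move=> YX [lB sB pB]; split=> [c x y z /YX Xx /YX Xy /YX Xz|x y /YX Xx /YX Xy|x /YX Xx].
- exact: lB.
- exact: sB.
- exact: pB.
Qed.

Lemma real_subspace_prod (V W : lmodType R[i]) (X : set V) (Y : set W) :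
  real_subspace X -> real_subspace Y ->
  real_subspace [set U : V * W | X U.1 /\ Y U.2].
Proof.
move=> [X0 Xl] [Y0 Yl]; split; first by split.
by move=> c U W' [XU YU] [XW YW]; split; [exact: Xl|exact: Yl].
Qed.

Lemma semi_inner_prod (V W : lmodType R[i]) (X : set V) (Y : set W) B C :
  semi_inner X B -> semi_inner Y C ->
  semi_inner [set U : V * W | X U.1 /\ Y U.2]
    (fun U U' => B U.1 U'.1 + C U.2 U'.2).
Proof.
move=> [lB sB pB] [lC sC pC]; split.
- move=> c U U' Z [XU YU] [XU' YU'] [XZ YZ] /=.
  by rewrite lB// lC//; ring.
- by move=> U U' [XU YU] [XU' YU']; rewrite sB// sC.
- by move=> U [XU YU]; rewrite addr_ge0 ?pB ?pC.
Qed.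

Lemma semi_inner_scale (V : lmodType R[i]) (X : set V) B (k : R) : 0 <= k ->
  semi_inner X B -> semi_inner X (fun x y => k * B x y).
Proof.
move=> k0 [lB sB pB]; split=> [c x y z Xx Xy Xz|x y Xx Xy|x Xx].
- by rewrite lB//; ring.
- by rewrite sB.
- by rewrite mulr_ge0// pB.
Qed.

End SemiInnerConstructions.

Section DampedSecondOrder.
Context {R : realType} {V : lmodType R[i]}.
Local Open Scope complex_scope.
Variables (H L : set V) (BH BL Q : V -> V -> R).
Hypotheses (subH : real_subspace H) (subL : real_subspace L) (HL : H `<=` L).
Hypotheses (hBH : semi_inner H BH) (hBL : semi_inner L BL) (hQ : semi_inner H Q).
Variables (c1 c2 : R) (c1_gt0 : 0 < c1) (c2_gt0 : 0 < c2).
Hypotheses (BL_Q : forall p, H p -> BL p p <= c1 * Q p p)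
  (Q_BH : forall p, H p -> Q p p <= c2 * BH p p).

Let X : set (V * V) := [set U | H U.1 /\ L U.2].
Let B (U W : V * V) := BH U.1 W.1 + BL U.2 W.2.

Variables (S : R -> V * V -> V * V) (D : set (V * V)) (A : V * V -> V * V).
Hypotheses (hS : C0_contraction_semigroup X (fun U => Num.sqrt (B U U)) S)
  (hA : is_generator X (fun U => Num.sqrt (B U U)) S D A)
  (hD : forall U, D U -> [/\ H U.2, (A U).1 = U.2, B (A U) U = - Q U.2 U.2 &
    BL (A U).2 U.1 = - BH U.1 U.1 - Q U.2 U.1]).

Let subX : real_subspace X := real_subspace_prod subH subL.
Let hB : semi_inner X B := semi_inner_prod hBH hBL.

(** The abstract form of the multiplier method. [BH] is the elastic energy, [BL]
    the kinetic one and [Q] the dissipation; the last two equations of [hD] are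
    the energy identity and the identity obtained by pairing the equation with the
    displacement. The Lyapunov functional is [B] plus a small multiple [e] of the
    pairing of velocity and displacement, whose derivative brings in the missing
    term [- BH U.1 U.1]. *)
Theorem damped_exponential_decay : exists2 alpha, 0 < alpha &
  forall U t, D U -> 0 <= t ->
    B (S t U) (S t U) <= 3 * expR (- (alpha * t)) * B (S 0 U) (S 0 U).
Proof.
have c3_gt0 : 0 < 1 + c1 * c2 by rewrite addr_gt0// mulr_gt0.
have c4_gt0 : 0 < c2 + 2 * c1 by rewrite addr_gt0// mulr_gt0.
(* The first bound on [e] keeps the functional within a factor 2 of [B]; the
   second one lets the dissipation absorb the error terms of the multiplier. *)
pose e := Num.min ((1 + c1 * c2)^-1 / 2) (c2 + 2 * c1)^-1.
have e_gt0 : 0 < e by rewrite lt_min divr_gt0 ?invr_gt0.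
have e1 : e * (1 + c1 * c2) <= 2^-1.
  by rewrite -ler_pdivlMr// mulrC ge_min lexx.
have e2 : e * (c2 + 2 * c1) <= 1.
  by rewrite -ler_pdivlMr// div1r ge_min lexx orbT.
pose P (U W : V * V) := B U W + e * (BL U.2 W.1 + BL U.1 W.2).
have cross U : X U -> `|e * (BL U.2 U.1 + BL U.1 U.2)| <= 2^-1 * B U U.
  move=> [HU LU]; rewrite normrM gtr0_norm// (semi_innerC hBL (HL HU) LU).
  have -> : BL U.2 U.1 + BL U.2 U.1 = 2 * BL U.2 U.1 by ring.
  have := semi_inner_young subL hBL ltr01 LU (HL HU); rewrite invr1 !mul1r => y.
  apply: (@le_trans _ _ (e * (1 + c1 * c2) * B U U)); last first.
    by rewrite ler_wpM2r// (semi_inner_ge0 hB).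
  rewrite -mulrA ler_pM2l// (le_trans y)// /B.
  have bh0 := semi_inner_ge0 hBH HU; have bl0 := semi_inner_ge0 hBL LU.
  have := le_trans (BL_Q HU) (ler_wpM2l (ltW c1_gt0) (Q_BH HU)).
  rewrite mulrA; have : 0 <= c1 * c2 * BL U.2 U.2 by rewrite !mulr_ge0// ltW.
  nra.
have PB U : X U -> 2^-1 * B U U <= P U U /\ P U U <= 3 / 2 * B U U.
  move=> XU; have := cross U XU; rewrite ler_norml => /andP[h1 h2].
  by rewrite /P; split; lra.
have hP : semi_inner X P.
  have [lB sB pB] := hB; have [lL sL pL] := hBL.
  split.
  - move=> c U U' W XU XU' XW.
    rewrite /P lB//; case: XU XU' XW => [HU LU] [HU' LU'] [HW LW] /=.
    by rewrite !lL//; do ? exact: HL; ring.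
  - move=> U W XU XW; rewrite /P sB//; case: XU XW => [HU LU] [HW LW].
    by rewrite (sL U.2)//; [rewrite (sL U.1)//; [ring|exact: HL]|exact: HL].
  - move=> U XU; apply: le_trans (PB U XU).1.
    by rewrite mulr_ge0// pB.
pose k := Num.min c1^-1 e.
have k_gt0 : 0 < k by rewrite lt_min invr_gt0 c1_gt0.
have DX U : D U -> X U by move=> DU; move: hA.1 => E; move: DU; rewrite E => -[].
have diss U : D U -> 2 * P (A U) U <= - (2 / 3 * k) * P U U.
  move=> DU; have [HU2 AU1 BAU LAU] := hD DU.
  have XU := DX _ DU; have [HU LU] := XU.
  have q22 := semi_inner_ge0 hQ HU2.
  have h11 := semi_inner_ge0 hBH HU; have l22 := semi_inner_ge0 hBL LU.
  have bl := BL_Q HU2.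
  have cq : c2^-1 * Q U.1 U.1 <= BH U.1 U.1.
    by rewrite mulrC ler_pdivrMr// mulrC; exact: Q_BH.
  have := semi_inner_young subH hQ c2_gt0 HU2 HU.
  rewrite ler_norml => /andP[yl _].
  have kB : k * B U U <= Q U.2 U.2 + e * BH U.1 U.1.
    rewrite /B mulrDr addrC lerD//.
      apply: (@le_trans _ _ (c1^-1 * BL U.2 U.2)).
        by rewrite ler_wpM2r// ge_min lexx.
      by rewrite mulrC ler_pdivrMr// mulrC.
    by rewrite ler_wpM2r// ge_min lexx orbT.
  apply: (@le_trans _ _ (- (k * B U U))); last first.
    have := (PB U XU).2; rewrite mulNr lerN2 => h.
    have -> : k * B U U = 2 / 3 * k * (3 / 2 * B U U) by field.
    by rewrite ler_pM2l// mulr_gt0.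
  apply: (@le_trans _ _ (- (Q U.2 U.2 + e * BH U.1 U.1))); last by rewrite lerN2.
  rewrite /P BAU LAU AU1.
  have h1 : e * (2 * (- Q U.2 U.1)) <= e * (c2 * Q U.2 U.2 + BH U.1 U.1).
    by rewrite ler_pM2l//; lra.
  have h2 : e * BL U.2 U.2 <= e * (c1 * Q U.2 U.2) by rewrite ler_pM2l.
  have h3 : e * (c2 + 2 * c1) * Q U.2 U.2 <= 1 * Q U.2 U.2 by rewrite ler_wpM2r.
  lra.
exists (2 / 3 * k); first by rewrite mulr_gt0.
move=> U t DU t0.
have k'0 : 0 <= 2 / 3 * k by rewrite mulr_ge0// ltW.
have := lyapunov_exponential_decay subX hB hS hA hP (fun x Xx => (PB x Xx).1)
  (fun x Xx => (PB x Xx).2) k'0 diss DU t0.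
set b := B (S t U) _; set b0 := B (S 0 U) _; set ex := expR _.
lra.
Qed.

End DampedSecondOrder.

(** * Smooth functions vanishing to all orders *)

Section Smooth.
Context {R : realType}.
Implicit Types (f g : R -> R) (x : R).

(** Recursion on the derivative, rather than iterated derivatives taken from
    outside, makes stability under sums and products a direct induction. *)
Fixpoint smooth n f : Prop :=
  if n is n'.+1 then (forall x, derivable f x 1) /\ smooth n' (derive1 f) else True.

Lemma smoothP f :
  (forall n, smooth n f) <-> forall n x, derivable (derive1n n f) x 1.
Proof.
split=> [sf n|df n].
  have {sf} := sf n.+1; elim: n f => [f []//|n ih f [_ /ih]].
  by rewrite /derive1n iterSr.
elim: n f df => [//|n ih f df]; split; first exact: (df 0%N).
by apply: ih => m x; have := df m.+1 x; rewrite /derive1n iterSr.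
Qed.

Lemma smoothW n f : smooth n.+1 f -> smooth n f.
Proof. by elim: n f => [//|n ih f [df /ih]]. Qed.

Lemma smoothD n f g : smooth n f -> smooth n g -> smooth n (f + g).
Proof.
elim: n f g => [//|n ih f g [df sf] [dg sg]]; split.
  by move=> x; apply: derivableD.
rewrite (_ : derive1 _ = (derive1 f) + (derive1 g)); first exact: ih.
apply/funext => x; rewrite derive1E deriveD; [|exact: df|exact: dg].
  by rewrite -!derive1E.
Qed.

Lemma smoothM n f g : smooth n f -> smooth n g -> smooth n (f * g).
Proof.
elim: n f g => [//|n ih f g sf sg]; have [[df sf'] [dg sg']] := (sf, sg).
split; first by move=> x; apply: derivableM.
rewrite (_ : derive1 _ = f * (derive1 g) + g * (derive1 f)).
  by apply: smoothD; apply: ih => //; exact: smoothW.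
apply/funext => x; rewrite derive1E deriveM; [|exact: df|exact: dg].
  by rewrite -!derive1E.
Qed.

Lemma smooth_cst n (k : R) : smooth n (cst k).
Proof.
elim: n k => [//|n ih k]; split; first by move=> x; exact: derivable_cst.
by rewrite (_ : derive1 _ = cst 0)//; apply/funext => x; rewrite derive1_cst.
Qed.

Lemma is_derive_affine f (k c df : R) x : is_derive (k * x + c) (1 : R) f df ->
  is_derive x (1 : R) (fun x => f (k * x + c)) (df * k).
Proof.
move=> dfx; have dkc : is_derive x (1 : R) (fun x => k * x + c) k.
  have dk := @is_deriveZ R R R id k x 1 1 (is_derive_id _ _).
  have := @is_deriveD R R R _ (cst c) x 1 _ 0 dk (is_derive_cst _ _ _).
  by rewrite addr0 [k *: _]mulr1.
exact (@is_derive1_comp R f (fun x => k * x + c) x df k dfx dkc).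
Qed.

Lemma smooth_affine n f (k c : R) : smooth n f ->
  smooth n (fun x => f (k * x + c)).
Proof.
elim: n f => [//|n ih f [df sf]].
have dfkc x : is_derive x (1 : R) (fun x => f (k * x + c)) (derive1 f (k * x + c) * k).
  by apply: is_derive_affine; rewrite derive1E; apply: derivableP; exact: df.
split; first by move=> x; case: (dfkc x).
rewrite (_ : derive1 _ = (fun x => derive1 f (k * x + c)) * cst k).
  by apply: smoothM; [exact: ih|exact: smooth_cst].
by apply/funext => x; rewrite derive1E; case: (dfkc x).
Qed.

(** Polynomials in [1/x] times [exp (- 1/x)] on the positive half line: a class
    stable under differentiation, whose members vanish to all orders at 0. *)
Definition flat (p : {poly R}) x : R :=
  if 0 < x then p.[x^-1] * expR (- x^-1) else 0.

(** The arbitrary rate [s] is what the induction on the degree consumes: half of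
    it bounds the quotient polynomial, the other half the factor ['X]. *)
Lemma horner_le_expR (p : {poly R}) (s : R) : 0 < s ->
  exists C, forall y, 0 <= y -> `|p.[y]| <= C * expR (s * y).
Proof.
elim/poly_ind: p s => [|p c ih] s s0.
  by exists 0 => y _; rewrite horner0 normr0 mul0r.
have s20 : 0 < s / 2 by rewrite divr_gt0.
have [C HC] := ih _ s20.
exists (C * (s / 2)^-1 + `|c|) => y y0.
have sy0 : 0 <= s * y by rewrite mulr_ge0// ltW.
rewrite hornerD hornerC hornerMX (le_trans (ler_normD _ _))// mulrDl lerD//.
  have C0 : 0 <= C * expR (s / 2 * y) by exact: le_trans (HC y y0).
  rewrite normrM (ger0_norm y0).
  apply: (@le_trans _ _ (C * expR (s / 2 * y) * ((s / 2)^-1 * expR (s / 2 * y)))).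
    apply: ler_pM => //; first exact: HC.
    rewrite ler_pdivlMl// (le_trans _ (expR_ge1Dx _))//.
    by rewrite lerDr.
  by rewrite mulrACA -expRD -mulrDl -splitr.
by rewrite ler_peMr// -expR0 ler_expR.
Qed.

Lemma flat_derive_pos p x : 0 < x ->
  is_derive x (1 : R) (flat p) (flat ('X^2 * (p - p^`())) x).
Proof.
move=> x0.
apply: (@near_eq_is_derive R R R (fun y => p.[y^-1] * expR (- y^-1)) (flat p) x 1).
  near=> y; rewrite /flat ifT//.
  by near: y; exact: lt_nbhsr.
have xN0 : x != 0 by rewrite gt_eqF.
have dV : is_derive x (1 : R) (fun y : R => y^-1) (- x ^- 2).
  apply: DeriveDef; first by apply: derivableV => //; exact: derivable_id.
  by rewrite deriveV ?derive_id ?scaler1//; exact: derivable_id.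
have dp : is_derive x (1 : R) (fun y : R => p.[y^-1]) (p^`().[x^-1] * - x ^- 2).
  exact (@is_derive1_comp R (horner p) (fun y => y^-1) x _ _ (is_derive_poly _ _) dV).
have dN : is_derive x (1 : R) (fun y : R => - y^-1) (- - x ^- 2).
  exact (@is_deriveN R R R (fun y : R => y^-1) x 1 _ dV).
have de : is_derive x (1 : R) (fun y : R => expR (- y^-1))
    (expR (- x^-1) * - - x ^- 2).
  exact (@is_derive1_comp R expR (fun y => - y^-1) x _ _ (is_derive_expR _) dN).
apply: (is_derive_eq (is_deriveM dp de)).
rewrite /flat x0 /GRing.scale/= hornerM hornerXn hornerD hornerN exprVn.
by ring.
Unshelve. all: by end_near. Qed.

(** In terms of [y = 1/h], the difference quotient at 0 is [h] times a polynomial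
    in [y] divided by [expR y], hence [O(h)]. *)
Lemma flat_derive0 p : is_derive (0 : R) (1 : R) (flat p) 0.
Proof.
have [C HC] := horner_le_expR ('X^2 * p) ltr01.
have f0 : flat p 0 = 0 by rewrite /flat ltxx.
have cvg0 : h^-1 *: (flat p (h *: 1 + 0) - flat p 0) @[h --> (0 : R)^'] --> (0 : R).
  apply/cvgr0Pnorm_le => e e0.
  have C1 : 0 < `|C| + 1 by rewrite ltr_wpDl.
  near=> h.
  have hN0 : h != 0 by near: h; exact: nbhs_dnbhs_neq.
  rewrite f0 subr0 addr0 [h *: 1]mulr1 /GRing.scale/= /flat.
  case: ifPn => [h0|_]; last by rewrite mulr0 normr0 ltW.
  have hV0 : 0 <= h^-1 by rewrite invr_ge0 ltW.
  have := HC _ hV0; rewrite mul1r hornerM hornerXn => H.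
  have -> : h^-1 * (p.[h^-1] * expR (- h^-1)) =
      h * (h^-1 ^+ 2 * p.[h^-1] / expR h^-1).
    by rewrite expRN; field; rewrite gt_eqF ?expR_gt0.
  rewrite normrM normf_div (gtr0_norm h0) (gtr0_norm (expR_gt0 _)).
  apply: (@le_trans _ _ (h * (`|C| + 1))).
    rewrite ler_pM2l// ler_pdivrMr ?expR_gt0// (le_trans H)// ler_pM2r ?expR_gt0//.
    by rewrite (le_trans (ler_norm _))// lerDl.
  rewrite -ler_pdivlMr// -[h]gtr0_norm//.
  by near: h; apply: dnbhs0_le; rewrite divr_gt0.
apply: DeriveDef; first by apply/cvg_ex; exists 0; exact: cvg0.
by apply/cvg_lim; [exact: Rhausdorff|exact: cvg0].
Unshelve. all: by end_near. Qed.

Lemma flat_derive p x :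
  is_derive x (1 : R) (flat p) (flat ('X^2 * (p - p^`())) x).
Proof.
have [x0|x0|->] := ltgtP x 0.
- have -> : flat ('X^2 * (p - p^`())) x = 0 by rewrite /flat ltNge ltW.
  apply: (@near_eq_is_derive R R R (cst 0) (flat p) x 1).
  near=> y; rewrite /flat ifF//; apply/negbTE; rewrite -leNgt ltW//.
  by near: y; exact: lt_nbhsl.
- exact: flat_derive_pos.
- by rewrite {2}/flat ltxx; exact: flat_derive0.
Unshelve. all: by end_near. Qed.

Lemma smooth_flat n p : smooth n (flat p).
Proof.
elim: n p => [//|n ih p]; split; first by move=> x; case: (flat_derive p x).
rewrite (_ : derive1 _ = flat ('X^2 * (p - p^`()))); first exact: ih.
by apply/funext => x; rewrite derive1E; case: (flat_derive p x).
Qed.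

Lemma flat1_itv x : 0 <= flat 1 x <= 1.
Proof.
rewrite /flat; case: ifPn => [x0|_]; last by rewrite lexx ler01.
by rewrite hornerC mul1r expR_ge0/= expR_le1 oppr_le0 invr_ge0 ltW.
Qed.

End Smooth.

(** * The fundamental lemma of the calculus of variations *)

Section TestFunctions.
Context {R : realType}.
Notation mu := (@lebesgue_measure R).
Implicit Types (a b c d k x : R) (f phi : R -> R).

Lemma flat1_cvg (u : nat -> R) :
  (forall A, \forall n \near \oo, A <= u n) -> flat 1 (u n) @[n --> \oo] --> (1 : R).
Proof.
move=> uoo; apply/cvgrPdist_le => e e0.
near=> n.
have un : e^-1 <= u n by near: n; exact: uoo.
have un0 : 0 < u n by apply: lt_le_trans un; rewrite invr_gt0.
rewrite ger0_norm ?subr_ge0; last by have /andP[] := flat1_itv (u n).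
rewrite /flat un0 hornerC mul1r lerBlDl -lerBlDr.
rewrite (le_trans _ (expR_ge1Dx _))// lerB// -[leRHS]invrK lef_pV2 ?posrE//.
by rewrite invr_gt0.
Unshelve. all: by end_near. Qed.

(** A smooth approximation of the indicator function of the interval from [a] to
    [d]. The shift by 1 moves the left end of the support to [a + 1/k], so that
    the approximation is compactly supported even when [a] is the end point of
    the interval under study. *)
Definition cutoff k a d x := flat 1 (k * (x - a) - 1) * flat 1 (k * (d - x)).

Lemma cutoff_itv k a d x : 0 <= cutoff k a d x <= 1.
Proof.
have /andP[p0 p1] := flat1_itv (k * (x - a) - 1).
have /andP[q0 q1] := flat1_itv (k * (d - x)).
by rewrite /cutoff mulr_ge0//= mulr_ile1.
Qed.

Lemma cutoff_out k a d x : 0 < k -> x \notin `]a, d[ -> cutoff k a d x = 0.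
Proof.
move=> k0; rewrite in_itv/= negb_and -!leNgt => /orP[xa|dx].
  rewrite /cutoff /flat ifF ?mul0r//; apply/negbTE; rewrite -leNgt.
  by rewrite subr_le0 (@le_trans _ _ 0)// mulr_ge0_le0 ?(ltW k0)// subr_le0.
rewrite /cutoff mulrC /flat ifF ?mul0r//; apply/negbTE; rewrite -leNgt.
by rewrite mulr_ge0_le0 ?(ltW k0)// subr_le0.
Qed.

Lemma test_function_cutoff k a b d :
  0 < k -> a + k^-1 <= d -> d < b -> test_function a b (cutoff k a d).
Proof.
move=> k0 akd db; split.
  apply/smoothP => n; rewrite (_ : cutoff k a d =
      (fun x => flat 1 (k * x + (- (k * a) - 1))) *
      (fun x => flat 1 (- k * x + k * d))).
    by apply: smoothM; apply: smooth_affine; exact: smooth_flat.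
  apply/funext => x; rewrite /cutoff fctE; congr (flat 1 _ * flat 1 _); ring.
exists (a + k^-1), d; split=> //; first by rewrite ltrDl invr_gt0.
move=> x; rewrite in_itv/= negb_and -!ltNge => /orP[xa|dx].
  rewrite /cutoff /flat ifF ?mul0r//; apply/negbTE; rewrite -leNgt.
  rewrite subr_le0 -ler_pdivlMl// mulr1 lerBlDl; exact: ltW.
by apply: cutoff_out => //; rewrite in_itv/= [x < d]ltNge (ltW dx) andbF.
Qed.

Lemma cutoff_cvg (N : nat) a d x : (0 < N)%N ->
  cutoff (n + N)%:R a d x @[n --> \oo] --> (\1_(`]a, d[) x : R).
Proof.
move=> N0; have [xad|xad] := boolP (x \in `]a, d[); last first.
  rewrite indicE memNset; last by move=> /=; exact/negP.
  rewrite (_ : (fun n => _) = cst 0); first exact: cvg_cst.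
  by apply/funext => n; apply: cutoff_out => //; rewrite ltr0n addn_gt0 N0 orbT.
rewrite indicE mem_set//; move: xad; rewrite in_itv/= => /andP[ax xd].
have large (c r A : R) : 0 < c -> \forall n \near \oo, A <= (n + N)%:R * c + r.
  move=> c0; near=> n.
  rewrite -lerBlDr -ler_pdivrMr// (@le_trans _ _ n%:R) ?ler_nat ?leq_addr//.
  near: n; exact: nbhs_infty_ger.
have -> : true%:R = 1 * 1 :> R by rewrite mulr1.
apply: cvgM; apply: flat1_cvg => A.
  by apply: (large _ (- 1)); rewrite subr_gt0.
have := large (d - x) 0 A; rewrite subr_gt0 => /(_ xd).
by apply: filterS => n; rewrite addr0.
Unshelve. all: by end_near. Qed.

Lemma test_function_continuous a b phi : test_function a b phi -> continuous phi.
Proof.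
move=> [sphi _] x; apply/differentiable_continuous/derivable1_diffP.
exact: (sphi 0%N).
Qed.

Lemma test_function_derive a b phi :
  test_function a b phi -> test_function a b (derive1 phi).
Proof.
move=> [sphi [c [d [ac cd db phi0]]]]; split.
  by move=> n x; have := sphi n.+1 x; rewrite /derive1n iterSr.
exists c, d; split=> // x xcd; rewrite derive1E.
have : \forall y \near x, cst 0 y = phi y.
  move: xcd; rewrite in_itv/= negb_and -!ltNge => /orP[xc|dx]; near=> y.
    rewrite phi0// in_itv/= negb_and -ltNge; apply/orP; left.
    by near: y; exact: lt_nbhsl.
  rewrite phi0// in_itv/= negb_and -!ltNge; apply/orP; right.
  by near: y; exact: lt_nbhsr.
move=> /near_eq_derive <-; exact: derive_cst.
Unshelve. all: by end_near. Qed.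

Lemma test_function_bounded a b phi :
  test_function a b phi -> exists M, forall x, `|phi x| <= M.
Proof.
move=> tphi; have cphi := test_function_continuous tphi.
have [_ [c [d [ac cd db phi0]]]] := tphi.
have cn : {within `[c, d], continuous (fun x => `|phi x|)}.
  apply: continuous_subspaceT => x; apply: (@continuous_comp _ _ _ phi).
    exact: cphi.
  exact: norm_continuous.
have [z zcd Hz] := EVT_max cd cn.
exists `|phi z| => x; have [xcd|xcd] := boolP (x \in `[c, d]); first exact: Hz.
by rewrite phi0// normr0.
Qed.

Lemma integrableM_bounded (D : set R) f phi : measurable D ->
  mu.-integrable D (EFin \o f) -> measurable_fun D phi ->
  (exists M, forall x, `|phi x| <= M) ->
  mu.-integrable D (EFin \o (fun x => f x * phi x)).
Proof.
move=> mD fi mphi [M HM].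
have bphi : [bounded phi x | x in D].
  exists M; split; first by rewrite num_real.
  by move=> y My x _; exact: (le_trans (HM x) (ltW My)).
have := @integrableMl _ _ _ mu D mD _ _ fi mphi bphi.
by apply: eq_integrable => // x _ /=; rewrite EFinM.
Qed.

Lemma integrableM_test a b f phi :
  mu.-integrable `]a, b[ (EFin \o f) -> test_function a b phi ->
  mu.-integrable `]a, b[ (EFin \o (fun x => f x * phi x)).
Proof.
move=> fi tphi; apply: integrableM_bounded => //.
  apply: measurable_funTS; apply: continuous_measurable_fun.
  exact: test_function_continuous tphi.
exact: test_function_bounded tphi.
Qed.

Lemma cvg_integral_cutoff a b d f : a < d -> d < b ->
  mu.-integrable `]a, b[ (EFin \o f) ->
  exists N : nat, [/\ (0 < N)%N,
    forall n, test_function a b (cutoff (n + N)%:R a d) &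
    \int[mu]_(x in `]a, b[) (f x * cutoff (n + N)%:R a d x) @[n --> \oo]
      --> \int[mu]_(x in `]a, d[) f x].
Proof.
move=> ad db fi.
(* With [N] at least [1 / (d - a)], the left end [a + 1 / (n + N)] of the support
   never exceeds [d]. *)
pose N := (Num.truncn (d - a)^-1).+1.
have da0 : 0 < d - a by rewrite subr_gt0.
have HN : (d - a)^-1 <= N%:R by rewrite ltW// truncnS_gt.
have N0 : (0 < N)%N by [].
exists N.
have kN n : 0 < (n + N)%:R :> R by rewrite ltr0n addn_gt0 N0 orbT.
have tc n : test_function a b (cutoff (n + N)%:R a d).
  apply: test_function_cutoff => //; rewrite -lerBrDl -[leRHS]invrK.
  by rewrite lef_pV2 ?posrE ?invr_gt0// (le_trans HN)// ler_nat leq_addl.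
split=> //.
have mab : measurable (`]a, b[ : set R) by [].
have mf := measurable_int _ fi.
have mc n : measurable_fun `]a, b[ (cutoff (n + N)%:R a d).
  apply: measurable_funTS; apply: continuous_measurable_fun.
  exact: test_function_continuous (tc n).
have mI : measurable_fun `]a, b[ (\1_(`]a, d[) : R -> R) by exact: measurable_indic.
have [|||||_ _] := @dominated_convergence _ _ _ mu _ mab
  (fun n x => (f x * cutoff (n + N)%:R a d x)%:E)
  (fun x => (f x * \1_(`]a, d[) x)%:E) (fun x => `|f x|%:E).
- move=> n; have := integrableM_test fi (tc n); exact: measurable_int.
- apply/measurable_EFinP; apply: measurable_funM => //; exact/measurable_EFinP.
- apply: aeW => x _; apply/cvg_EFin; first exact: nearW.
  by apply: cvgM; [exact: cvg_cst|exact: cutoff_cvg].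
- exact: integrable_norm.
- apply: aeW => x n _; rewrite /= lee_fin normrM ler_piMr//.
  by have /andP[? ?] := cutoff_itv (n + N)%:R a d x; rewrite ger0_norm.
have fiI : mu.-integrable `]a, b[ (EFin \o (fun x => f x * \1_(`]a, d[) x)).
  apply: integrableM_bounded => //; exists 1 => x.
  by rewrite indicE; case: (_ \in _); rewrite ?normr1 ?normr0.
have -> : (\int[mu]_(x in `]a, b[) (f x * \1_(`]a, d[) x)%:E)%E =
    (\int[mu]_(x in `]a, d[) f x)%:E.
  rewrite /Rintegral fineK; last first.
    apply: integrable_fin_num => //; apply: integrableS fi => //.
    by apply: subset_itvl; rewrite bnd_simp ltW.
  have {2}-> : `]a, d[%classic = `]a, b[ `&` `]a, d[.
    by rewrite setIidr//; apply: subset_itvl; rewrite bnd_simp ltW.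
  rewrite integral_mkcondr; apply: eq_integral => x _.
  by rewrite indicE patchE; case: ifPn => _; rewrite ?mulr1 ?mulr0.
move=> /fine_cvgP[_]; apply: cvg_trans.
by apply: near_eq_cvg; apply: nearW.
Qed.

(** Testing with cutoff functions shows that the primitive of [f] vanishes, hence
    so does [f], by Lebesgue differentiation. *)
Lemma ae0_of_test a b f : a < b -> mu.-integrable `]a, b[ (EFin \o f) ->
  (forall phi, test_function a b phi -> \int[mu]_(x in `]a, b[) (f x * phi x) = 0) ->
  {ae mu, forall x, x \in `]a, b[ -> f x = 0}.
Proof.
move=> ab fi f0.
have prim0 d : a < d -> d < b -> \int[mu]_(x in `]a, d[) f x = 0.
  move=> ad db; have [N [_ tc fc]] := cvg_integral_cutoff ad db fi.
  apply: (cvg_unique _ fc); first exact: Rhausdorff.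
  rewrite (_ : (fun n => _) = cst 0); first exact: cvg_cst.
  by apply/funext => n; exact: f0.
(* The first theorem of calculus at Lebesgue points is stated for locally
   integrable functions on the whole line. *)
pose g := f \_ `]a, b[.
have lg : locally_integrable setT g by exact: integrable_locally_restrict.
have gi y : mu.-integrable [set` Interval (BRight a) (BRight y)] (EFin \o g).
  have : mu.-integrable setT (EFin \o g).
    by rewrite -restrict_EFin; apply/integrable_restrict => //=; rewrite setTI.
  by apply: integrableS.
have := FTC1 gi lg; apply: filterS; first exact: (ae_filter_ringOfSetsType mu).
move=> x H xab.
move: (xab); rewrite in_itv/= => /andP[ax xb].
have [|_] := H; first by rewrite lte_fin.
have -> : g x = f x by rewrite /g patchE mem_set.
move=> <-; rewrite derive1E.
rewrite -(@near_eq_derive _ _ _ (cst 0)) ?derive_cst//.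
near=> y.
have ay : a < y by near: y; exact: lt_nbhsr.
have yb : y < b by near: y; exact: lt_nbhsl.
rewrite -Rintegral_itv_bndo_bndc; last by apply: integrableS (gi y) => //; apply: subset_itvl; rewrite bnd_simp.
rewrite -(prim0 y ay yb); apply: eq_Rintegral => z; rewrite inE => zay.
rewrite /g patchE mem_set//; move: zay; apply: subset_itvl.
by rewrite bnd_simp ltW.
Unshelve. all: by end_near. Qed.

End TestFunctions.

(** * Test functions and primitives *)

Section WeakDerivative.
Context {R : realType}.
Notation mu := (@lebesgue_measure R).
Implicit Types (a b c d k x : R) (f g h phi psi : R -> R).

Lemma integrableD_real (D : set R) f g : measurable D ->
  mu.-integrable D (EFin \o f) -> mu.-integrable D (EFin \o g) ->
  mu.-integrable D (EFin \o (fun x => f x + g x)).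
Proof. by move=> mD fi gi; exact: (@integrableD _ _ _ mu D mD _ _ fi gi). Qed.

Lemma integrableZ_real (D : set R) k f : measurable D ->
  mu.-integrable D (EFin \o f) -> mu.-integrable D (EFin \o (fun x => k * f x)).
Proof. by move=> mD fi; exact: (@integrableZl _ _ _ mu D mD k _ fi). Qed.

Lemma integrableB_real (D : set R) f g : measurable D ->
  mu.-integrable D (EFin \o f) -> mu.-integrable D (EFin \o g) ->
  mu.-integrable D (EFin \o (fun x => f x - g x)).
Proof. by move=> mD fi gi; exact: (@integrableB _ _ _ mu D mD _ _ fi gi). Qed.

Lemma integrable_norm_real (D : set R) f : mu.-integrable D (EFin \o f) ->
  mu.-integrable D (EFin \o (fun x => `|f x|)).
Proof. exact: (@integrable_norm _ _ _ mu D f). Qed.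

Lemma le_normr_Rintegral_real (D : set R) f : measurable D ->
  mu.-integrable D (EFin \o f) ->
  `|\int[mu]_(x in D) f x| <= \int[mu]_(x in D) `|f x|.
Proof. by move=> mD; exact: (@le_normr_Rintegral _ _ _ mu D f mD). Qed.

Lemma test_function_lin a b k phi psi : test_function a b phi ->
  test_function a b psi -> test_function a b (fun x => phi x + k * psi x).
Proof.
move=> [sphi [c [d [ac cd db phi0]]]] [spsi [c' [d' [ac' cd' db' psi0]]]]; split.
  apply/smoothP => n.
  apply: (@smoothD _ _ phi (cst k * psi)); first exact: (smoothP phi).2.
  by apply: smoothM; [exact: smooth_cst|exact: (smoothP psi).2].
exists (Num.min c c'), (Num.max d d'); split.
- by rewrite lt_min ac.
- by rewrite ge_min le_max cd.
- by rewrite gt_max db.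
- move=> x; rewrite in_itv/= negb_and -!ltNge lt_min gt_max => H.
  rewrite phi0 ?psi0 ?mulr0 ?addr0//; rewrite in_itv/= negb_and -!ltNge.
    by case/orP: H => /andP[h1 h2]; rewrite ?h1 ?h2 ?orbT.
  by case/orP: H => /andP[h1 h2]; rewrite ?h1 ?h2 ?orbT.
Qed.

Lemma integrable_test a b phi : test_function a b phi ->
  mu.-integrable setT (EFin \o phi).
Proof.
move=> tphi; have cphi := test_function_continuous tphi.
have [_ [c [d [_ _ _ phi0]]]] := tphi.
have -> : EFin \o phi = (EFin \o phi) \_ `[c, d].
  apply/funext => x; rewrite patchE; case: ifPn => // /negP xcd /=.
  by rewrite phi0//; apply/negP => xcd'; apply: xcd; rewrite inE.
apply/(integrable_mkcond _ _).1 => //.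
apply: continuous_compact_integrable; first exact: segment_compact.
exact: continuous_subspaceT.
Qed.

(** The primitive vanishes to the left of the support of [psi], and to its right
    because the total integral is 0. *)
Lemma test_function_primitive a b psi : test_function a b psi ->
  \int[mu]_(x in `]a, b[) psi x = 0 ->
  exists2 phi, test_function a b phi & derive1 phi = psi.
Proof.
move=> tpsi psi_int; have cpsi := test_function_continuous tpsi.
have ipsi := integrable_test tpsi.
pose phi x := \int[mu]_(t in [set` Interval -oo%O (BRight x)]) psi t.
have dphi x : derivable phi x 1 /\ derive1 phi x = psi x.
  apply: (@continuous_FTC1 _ psi -oo%O x (x + 1)) => //; first by rewrite ltrDl.
    exact: integrableS ipsi.
    by rewrite ltNyr.
  exact: cpsi.
have phiE : derive1 phi = psi by apply/funext => x; exact: (dphi x).2.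
exists phi => //.
have [spsi [c [d [ac cd db psi0]]]] := tpsi.
split.
  apply/smoothP; case=> [//|n]; split; first by move=> x; exact: (dphi x).1.
  by rewrite phiE; exact: (smoothP psi).2.
exists c, d; split=> // x; rewrite in_itv/= negb_and -!ltNge => /orP[xc|dx].
  rewrite /phi (_ : Rintegral _ _ _ = \int[mu]_(t in [set` Interval -oo%O (BRight x)]) cst 0 t).
    by rewrite Rintegral_cst//= mul0r.
  apply: eq_Rintegral => y; rewrite inE/= in_itv/= => yx.
  by rewrite psi0// in_itv/= negb_and -ltNge (le_lt_trans yx xc).
rewrite /phi -psi_int [LHS]Rintegral_mkcond [RHS]Rintegral_mkcond.
apply: eq_Rintegral => y _; rewrite !patchE.
have [ycd|ycd] := boolP (y \in `[c, d]); last by rewrite psi0//; do 2 case: ifPn.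
move: ycd; rewrite in_itv/= => /andP[cy yd].
by rewrite !mem_set//= in_itv/= ?(lt_le_trans ac cy) ?(le_lt_trans yd db)//
  (le_trans yd (ltW dx)).
Qed.

Lemma integrable_cst_itv a b k : mu.-integrable `]a, b[ (EFin \o cst k).
Proof.
apply: measurable_bounded_integrable => //; last exact: bounded_cst.
by rewrite /= lebesgue_measure_itv/=; case: ifP => _; rewrite ?ltry.
Qed.

Lemma Rintegral_cst_itv a b k : a <= b -> \int[mu]_(x in `]a, b[) k = k * (b - a).
Proof.
move=> ab; rewrite Rintegral_cst//= lebesgue_measure_itv/= lte_fin.
move: ab; rewrite le_eqVlt => /predU1P[->|ab]; first by rewrite ltxx subrr.
by rewrite ab.
Qed.

Lemma test_function_normalized a b : a < b ->
  exists2 theta, test_function a b theta & \int[mu]_(x in `]a, b[) theta x = 1.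
Proof.
move=> ab; pose d := (a + b) / 2.
have [ad db] := midf_lt ab.
have [N [_ tc]] := cvg_integral_cutoff ad db (integrable_cst_itv a b 1).
rewrite Rintegral_cst_itv ?(ltW ad)// mul1r => /cvgr_gt/(_ 0).
rewrite subr_gt0 => /(_ ad) [n _ /(_ n (leqnn _))] /=.
set t := cutoff _ _ _ in tc *; set I := Rintegral _ _ _ => I0.
have It : I = \int[mu]_(x in `]a, b[) t x.
  by apply: eq_Rintegral => x _; rewrite mul1r.
have it : mu.-integrable `]a, b[ (EFin \o t).
  by apply: integrableS (integrable_test (tc n)).
exists (fun x => 0 * t x + I^-1 * t x).
  have := test_function_lin (I^-1 - 1) (tc n) (tc n).
  by congr (test_function a b _); apply/funext => x; rewrite -/t; ring.
under eq_Rintegral do rewrite mul0r add0r.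
by rewrite RintegralZl// -It mulVf// gt_eqF.
Qed.

(** Subtracting from a test function its integral times a fixed [theta] of
    integral 1 leaves the derivative of a test function; hence [f] is orthogonal,
    up to the constant [K], to every test function. *)
Lemma ae_cst_of_test_derive a b f : a < b -> mu.-integrable `]a, b[ (EFin \o f) ->
  (forall phi, test_function a b phi ->
    \int[mu]_(x in `]a, b[) (f x * derive1 phi x) = 0) ->
  exists K, {ae mu, forall x, x \in `]a, b[ -> f x = K}.
Proof.
move=> ab fi f0; have [theta ttheta theta1] := test_function_normalized ab.
pose K := \int[mu]_(x in `]a, b[) (f x * theta x); exists K.
have itest phi : test_function a b phi -> mu.-integrable `]a, b[ (EFin \o phi).
  by move=> /integrable_test; exact: integrableS.
have mab : measurable (`]a, b[ : set R) by [].
have iK : mu.-integrable `]a, b[ (EFin \o (fun x => f x - K)).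
  exact: integrableB_real (integrable_cst_itv a b K).
suff : {ae mu, forall x, x \in `]a, b[ -> f x - K = 0}.
  apply: filterS; first exact: (ae_filter_ringOfSetsType mu).
  by move=> x H /H/eqP; rewrite subr_eq0 => /eqP.
apply: ae0_of_test => // psi tpsi.
pose q := \int[mu]_(x in `]a, b[) psi x.
have [||phi tphi phiE] := @test_function_primitive a b (fun x => psi x + - q * theta x).
- exact: test_function_lin.
- rewrite RintegralD//; [|exact: itest|]; last first.
    exact: integrableZ_real (itest _ ttheta).
  by rewrite RintegralZl ?theta1 ?mulr1 ?subrr//; exact: itest.
have := f0 _ tphi; rewrite phiE.
have ift := integrableM_test fi ttheta.
have ifp := integrableM_test fi tpsi.
under eq_Rintegral do rewrite mulrDr mulrCA.
rewrite RintegralD//; last exact: integrableZ_real.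
rewrite RintegralZl// -/K => H.
under eq_Rintegral do rewrite mulrBl.
rewrite RintegralB//; last exact: (integrableZ_real _ _ (itest _ tpsi)).
by rewrite RintegralZl ?itest// -/q; move: H; rewrite mulNr mulrC.
Qed.

(** Open intervals, because functions on the interval from [a] to [b] have no
    prescribed values at the end points. *)
Definition prim a g x := \int[mu]_(t in `]a, x[) g t.

Lemma primE a b g x : a <= x <= b -> mu.-integrable `]a, b[ (EFin \o g) ->
  prim a g x = parameterized_integral mu a x (g \_ `]a, b[).
Proof.
move=> /andP[ax xb] ig; rewrite /prim /parameterized_integral.
have ig' : mu.-integrable setT (EFin \o (g \_ `]a, b[)).
  by rewrite -restrict_EFin; apply/integrable_restrict => //=; rewrite setTI.
rewrite -Rintegral_itv_obnd_cbnd; last exact: integrableS ig'.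
rewrite -Rintegral_itv_bndo_bndc; last exact: integrableS ig'.
apply: eq_Rintegral => t; rewrite inE => tax; rewrite patchE mem_set//.
by move: tax; apply: subset_itvl; rewrite bnd_simp.
Qed.

Lemma prim_continuous a b g : a <= b -> mu.-integrable `]a, b[ (EFin \o g) ->
  {within `[a, b], continuous (prim a g)}.
Proof.
move=> ab ig.
have ig' : mu.-integrable setT (EFin \o (g \_ `]a, b[)).
  by rewrite -restrict_EFin; apply/integrable_restrict => //=; rewrite setTI.
have : mu.-integrable `[a, b] (EFin \o (g \_ `]a, b[)) by exact: integrableS ig'.
move=> /(parameterized_integral_continuous ab) cP.
apply: (subspace_eq_continuous _ cP) => x; rewrite inE/= in_itv/= => xab.
by rewrite /from_subspace (primE xab ig).
Qed.

Lemma primB a b g x y : a <= x -> x <= y -> y <= b ->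
  mu.-integrable `]a, b[ (EFin \o g) ->
  prim a g y - prim a g x = \int[mu]_(t in `]x, y[) g t.
Proof.
move=> ax xy yb ig.
have igS u v : a <= u -> v <= b -> mu.-integrable `]u, v[ (EFin \o g).
  move=> au vb; apply: integrableS ig => //.
  by apply: subset_itv; rewrite bnd_simp.
move: xy; rewrite le_eqVlt => /predU1P[<-|xy].
  by rewrite subrr set_itvoo0 ?Rintegral_set0.
rewrite /prim [X in _ - X]Rintegral_itv_bndo_bndc; last first.
  by apply: igS => //; rewrite (le_trans (ltW xy)).
by rewrite Rintegral_itvB// ?bnd_simp//; apply: igS.
Qed.

End WeakDerivative.

(** * Weak derivatives and primitives *)

Section WeakPrimitive.
Context {R : realType}.
Notation mu := (@lebesgue_measure R).
Implicit Types (a b c d k x : R) (f g h phi psi : R -> R).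

Lemma Rintegral_itv_cc_oo a b f : mu.-integrable `[a, b] (EFin \o f) ->
  \int[mu]_(x in `[a, b]) f x = \int[mu]_(x in `]a, b[) f x.
Proof.
move=> fi.
have fS (i j : itv_bound R) : [set` Interval i j] `<=` `[a, b] ->
    mu.-integrable [set` Interval i j] (EFin \o f).
  by move=> ij; exact: integrableS fi.
rewrite -Rintegral_itv_obnd_cbnd; last first.
  by apply: fS; apply: subset_itvr; rewrite bnd_simp.
rewrite -Rintegral_itv_bndo_bndc//.
by apply: fS; apply: subset_itv; rewrite bnd_simp.
Qed.

Lemma continuous_prim_by_parts a b h phi : a < b -> continuous h ->
  test_function a b phi ->
  \int[mu]_(x in `]a, b[) (prim a h x * derive1 phi x) =
  - \int[mu]_(x in `]a, b[) (h x * phi x).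
Proof.
move=> ab ch tphi; have cphi := test_function_continuous tphi.
have cphi' := test_function_continuous (test_function_derive tphi).
have [sphi [c [d [ac cd db phi0]]]] := tphi.
have ih u v : mu.-integrable `[u, v] (EFin \o h).
  apply: continuous_compact_integrable; first exact: segment_compact.
  exact: continuous_subspaceT.
pose H x := parameterized_integral mu a x h.
have H' x : a < x -> derivable H x 1 /\ derive1 H x = h x.
  move=> ax; apply: (@continuous_FTC1_closed _ h a x (x + 1)) => //.
    by rewrite ltrDl.
  exact: ch.
have cH : {within `[a, b], continuous H}.
  exact: (parameterized_integral_continuous (ltW ab) (ih a b)).
have := @Rintegration_by_parts _ H phi h (derive1 phi) a b ab.
rewrite !phi0 ?in_itv/= ?negb_and -?ltNge ?ac ?db ?orbT// !mulr0 subrr sub0r.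
have HoLR : derivable_oo_LRcontinuous H a b.
  split; first by move=> x; rewrite in_itv/= => /andP[ax _]; exact: (H' x ax).1.
    rewrite {2}/H /parameterized_integral set_itv1 Rintegral_set1.
    apply: cvg_at_right_filter.
    exact: (parameterized_integral_cvg_left ab (ih a b)).
  exact: (parameterized_integral_cvg_at_left ab (ih a b)).
have phioLR : derivable_oo_LRcontinuous phi a b.
  split; first by move=> x _; exact: (sphi 0%N).
    by apply: cvg_at_right_filter; exact: cphi.
  by apply: cvg_at_left_filter; exact: cphi.
move=> ibp; have {}ibp := ibp (continuous_subspaceT ch) HoLR _
  (continuous_subspaceT cphi') phioLR (fun _ _ => erefl).
have {}ibp := ibp (fun x xab => (H' x (proj1 (andP xab))).2).
rewrite Rintegral_itv_cc_oo in ibp; last first.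
  apply: continuous_compact_integrable; first exact: segment_compact.
  by move=> x; apply: continuousM; [exact: cH|exact: continuous_subspaceT].
rewrite Rintegral_itv_cc_oo in ibp; last first.
  apply: continuous_compact_integrable; first exact: segment_compact.
  apply: continuous_subspaceT => x; apply: continuousM; [exact: ch|exact: cphi].
rewrite -ibp; apply: eq_Rintegral => x _; congr (_ * _).
rewrite /H /parameterized_integral /prim Rintegral_itv_cc_oo//.
Qed.

Lemma continuous_integrable_itvoo a b f : {within `[a, b], continuous f} ->
  mu.-integrable `]a, b[ (EFin \o f).
Proof.
move=> cf; have := continuous_compact_integrable (@segment_compact _ a b) cf.
apply: integrableS => //; apply: subset_itv; rewrite bnd_simp//.
Qed.

(** For continuous [g] this is integration by parts; the general case follows
    because both sides are continuous in [g] for the L1 norm. *)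
Lemma prim_by_parts a b g phi : a < b -> mu.-integrable `]a, b[ (EFin \o g) ->
  test_function a b phi ->
  \int[mu]_(x in `]a, b[) (prim a g x * derive1 phi x) =
  - \int[mu]_(x in `]a, b[) (g x * phi x).
Proof.
move=> ab ig tphi; have tphi' := test_function_derive tphi.
have [M HM] := test_function_bounded tphi.
have [M' HM'] := test_function_bounded tphi'.
have M0 : 0 <= M by exact: le_trans (HM 0).
have M'0 : 0 <= M' by exact: le_trans (HM' 0).
have mab : measurable (`]a, b[ : set R) by [].
have iprim h : mu.-integrable `]a, b[ (EFin \o h) ->
    mu.-integrable `]a, b[ (EFin \o prim a h).
  by move=> ih; apply: continuous_integrable_itvoo; exact: prim_continuous (ltW ab) ih.
apply/eqP; rewrite -addr_eq0 -normr_le0; apply/ler_addgt0Pr => e e0; rewrite add0r.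
have [|||h_ [ch ih gh]] := @approximation_continuous_integrable R `]a, b[ g.
- by [].
- by rewrite /= lebesgue_measure_itv/=; case: ifP => _; rewrite ?ltry.
- exact: ig.
pose C := M' * (b - a) + M.
have C0 : 0 <= C by rewrite addr_ge0// mulr_ge0// subr_ge0 ltW.
have e'0 : 0 < e / (C + 1) by rewrite divr_gt0// ltr_wpDl.
have [n Hn] : exists n, \int[mu]_(x in `]a, b[) `|g x - h_ n x| < e / (C + 1).
  have /fine_cvgP[_ /cvgr_lt/(_ _ e'0) [n _ Hn]] := gh.
  by exists n; have := Hn n (leqnn _).
move: (h_ n) (ch n) (ih n) Hn => h {ch} ch {}ih Hn {gh}.
set D := \int[mu]_(x in `]a, b[) `|g x - h x| in Hn.
have igh : mu.-integrable `]a, b[ (EFin \o (fun x => g x - h x)) by exact: integrableB_real.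
have ighn : mu.-integrable `]a, b[ (EFin \o (fun x => `|g x - h x|)).
  exact: integrable_norm_real.
have E : \int[mu]_(x in `]a, b[) (prim a g x * derive1 phi x) +
    \int[mu]_(x in `]a, b[) (g x * phi x) =
    \int[mu]_(x in `]a, b[) ((prim a g x - prim a h x) * derive1 phi x) +
    \int[mu]_(x in `]a, b[) ((g x - h x) * phi x).
  under [X in _ = X + _]eq_Rintegral do rewrite mulrBl.
  under [X in _ = _ + X]eq_Rintegral do rewrite mulrBl.
  rewrite !RintegralB//; try (by apply: integrableM_test => //; exact: iprim).
  rewrite (continuous_prim_by_parts ab ch tphi); ring.
rewrite E (le_trans (ler_normD _ _))//.
have D0 : 0 <= D by apply: Rintegral_ge0 => x _.
have bound1 : `|\int[mu]_(x in `]a, b[) ((prim a g x - prim a h x) * derive1 phi x)|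
    <= M' * (b - a) * D.
  have ip : mu.-integrable `]a, b[ (EFin \o (fun x => (prim a g x - prim a h x) * derive1 phi x)).
    by apply: integrableM_test => //; apply: integrableB_real => //; exact: iprim.
  rewrite (le_trans (le_normr_Rintegral_real mab ip))//.
  rewrite mulrAC -(Rintegral_cst_itv (M' * D) (ltW ab)).
  apply: le_Rintegral => //; [|exact: integrable_cst_itv|].
    exact: (integrable_norm_real ip).
  move=> x; rewrite /= in_itv/= => /andP[ax xb]; rewrite normrM mulrC ler_pM//.
  have igS (k : R -> R) : mu.-integrable `]a, b[ (EFin \o k) -> mu.-integrable `]a, x[ (EFin \o k).
    by apply: integrableS => //; apply: subset_itvl; rewrite bnd_simp ltW.
  rewrite /prim -RintegralB//; [|exact: igS|exact: igS].
  rewrite (le_trans (le_normr_Rintegral_real _ _))//; first exact: igS.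
  rewrite /D (_ : `]a, x[%classic = `]a, b[ `&` `]a, x[); last first.
    by rewrite setIidr//; apply: subset_itvl; rewrite bnd_simp ltW.
  rewrite Rintegral_mkcondr; apply: le_Rintegral => //.
    rewrite -restrict_EFin; apply/integrable_restrict => //.
    by apply: integrableS ighn => //; exact: measurableI.
  by move=> t _; rewrite patchE; case: ifP => _; [exact: lexx|exact: normr_ge0].
have bound2 : `|\int[mu]_(x in `]a, b[) ((g x - h x) * phi x)| <= M * D.
  have ip : mu.-integrable `]a, b[ (EFin \o (fun x => (g x - h x) * phi x)).
    exact: integrableM_test.
  rewrite (le_trans (le_normr_Rintegral_real mab ip))//.
  rewrite -RintegralZl//; apply: le_Rintegral => //.
  - exact: (integrable_norm_real ip).
  - exact: integrableZ_real.
  - by move=> x _; rewrite normrM mulrC ler_wpM2r.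
rewrite (le_trans (lerD bound1 bound2))// -mulrDl -/C.
rewrite (@le_trans _ _ (C * (e / (C + 1))))//; first by rewrite ler_wpM2l// ltW.
rewrite mulrA ler_pdivrMr ?ltr_wpDl// mulrC ler_wpM2l ?(ltW e0)//.
by rewrite lerDl.
Qed.

(** The weak derivative of [f - prim a g] is 0, and only constants have that
    property. *)
Lemma weak_derivative_primitive a b f g : a < b ->
  mu.-integrable `]a, b[ (EFin \o f) -> mu.-integrable `]a, b[ (EFin \o g) ->
  (forall phi, test_function a b phi ->
    \int[mu]_(x in `]a, b[) (f x * derive1 phi x) =
    - \int[mu]_(x in `]a, b[) (g x * phi x)) ->
  exists K, {ae mu, forall x, x \in `]a, b[ -> f x = K + prim a g x}.
Proof.
move=> ab fi gi wfg.
have pi : mu.-integrable `]a, b[ (EFin \o prim a g).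
  by apply: continuous_integrable_itvoo; exact: prim_continuous (ltW ab) gi.
have fpi : mu.-integrable `]a, b[ (EFin \o (fun x => f x - prim a g x)).
  exact: integrableB_real.
have [phi tphi|K HK] := ae_cst_of_test_derive ab fpi.
  have tphi' := test_function_derive tphi.
  under eq_Rintegral do rewrite mulrBl.
  rewrite RintegralB//; [|exact: integrableM_test..].
  by rewrite wfg// prim_by_parts// subrr.
exists K; move: HK; apply: filterS; first exact: (ae_filter_ringOfSetsType mu).
by move=> x H /H <-; rewrite subrK.
Qed.

(** The variance of [g] is nonnegative. *)
Lemma sqr_Rintegral_le a b g : a <= b -> mu.-integrable `]a, b[ (EFin \o g) ->
  mu.-integrable `]a, b[ (EFin \o (fun x => g x ^+ 2)) ->
  (\int[mu]_(x in `]a, b[) g x) ^+ 2 <= (b - a) * \int[mu]_(x in `]a, b[) g x ^+ 2.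
Proof.
rewrite le_eqVlt => /predU1P[<- _ _|ab ig ig2].
  by rewrite subrr mul0r set_itvoo0 Rintegral_set0 expr0n.
set I := \int[mu]_(x in _) g x; set J := \int[mu]_(x in _) g x ^+ 2.
have ba : 0 < b - a by rewrite subr_gt0.
pose m := I / (b - a).
have : 0 <= \int[mu]_(x in `]a, b[) ((g x ^+ 2 + - (2 * m) * g x) + m ^+ 2).
  apply: Rintegral_ge0 => x _.
  by rewrite (_ : _ + _ = (g x - m) ^+ 2) ?sqr_ge0//; ring.
rewrite RintegralD//; [|by apply: integrableD_real => //; exact: integrableZ_real|exact: integrable_cst_itv].
rewrite RintegralD//; last exact: integrableZ_real.
rewrite RintegralZl// Rintegral_cst_itv ?(ltW ab)// -/I -/J.
have -> : J + - (2 * m) * I + m ^+ 2 * (b - a) = J - I ^+ 2 / (b - a).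
  by rewrite /m; field; rewrite gt_eqF.
by rewrite subr_ge0 ler_pdivrMr// mulrC.
Qed.

Lemma prim_variation a b g x y : a <= x <= b -> a <= y <= b ->
  mu.-integrable `]a, b[ (EFin \o g) ->
  mu.-integrable `]a, b[ (EFin \o (fun x => g x ^+ 2)) ->
  (prim a g y - prim a g x) ^+ 2 <= (b - a) * \int[mu]_(x in `]a, b[) g x ^+ 2.
Proof.
wlog xy : x y / x <= y => [H xab yab ig ig2|].
  have [xy|/ltW yx] := leP x y; first exact: H.
  by rewrite -sqrrN opprB; exact: H.
move=> /andP[ax xb] /andP[ay yb] ig ig2; rewrite (primB ax xy yb ig).
have S : `]x, y[ `<=` `]a, b[ by apply: subset_itv; rewrite bnd_simp.
have igS (k : R -> R) : mu.-integrable `]a, b[ (EFin \o k) -> mu.-integrable `]x, y[ (EFin \o k).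
  by apply: integrableS.
rewrite (le_trans (sqr_Rintegral_le xy _ _))//; [exact: igS|exact: igS|].
apply: ler_pM; rewrite ?subr_ge0//.
- by apply: Rintegral_ge0 => t _; rewrite sqr_ge0.
- lra.
- rewrite (_ : `]x, y[%classic = `]a, b[ `&` `]x, y[); last by rewrite setIidr.
  rewrite Rintegral_mkcondr; apply: le_Rintegral => //.
    rewrite -restrict_EFin; apply/integrable_restrict => //.
    by apply: integrableS ig2 => //; exact: measurableI.
  by move=> t _; rewrite patchE; case: ifP; rewrite ?sqr_ge0.
Qed.

End WeakPrimitive.

(** * Complex-valued square-integrable functions *)

Section ComplexL2.
Context {R : realType}.
Notation mu := (@lebesgue_measure R).
Local Open Scope complex_scope.
Implicit Types (a b c r x : R) (f g u v : R -> R[i]) (p q : R -> R).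

Definition rL2 a b p := measurable_fun `]a, b[ p /\
  mu.-integrable `]a, b[ (EFin \o (fun x => p x ^+ 2)).

Lemma ae_filterS (P Q : R -> Prop) : (forall x, P x -> Q x) ->
  {ae mu, forall x, P x} -> {ae mu, forall x, Q x}.
Proof. by move=> PQ; apply: filterS => //; exact: (ae_filter_ringOfSetsType mu). Qed.

Lemma ae_filterS2 (P Q S : R -> Prop) : (forall x, P x -> Q x -> S x) ->
  {ae mu, forall x, P x} -> {ae mu, forall x, Q x} -> {ae mu, forall x, S x}.
Proof. by move=> PQ; apply: filterS2 => //; exact: (ae_filter_ringOfSetsType mu). Qed.

Lemma rL2M a b p q : rL2 a b p -> rL2 a b q ->
  mu.-integrable `]a, b[ (EFin \o (fun x => p x * q x)).
Proof.
move=> [mp ip] [mq iq].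
have ipq : mu.-integrable `]a, b[ (EFin \o (fun x => p x ^+ 2 + q x ^+ 2)).
  exact: integrableD_real.
apply: (le_integrable _ _ _ ipq) => //.
  by apply/measurable_EFinP; exact: measurable_funM.
move=> x _; rewrite /= lee_fin [leRHS]ger0_norm ?addr_ge0 ?sqr_ge0//.
rewrite ler_norml; apply/andP; split.
  by have := sqr_ge0 (p x + q x); have := sqr_ge0 (p x); have := sqr_ge0 (q x); nra.
by have := sqr_ge0 (p x - q x); have := sqr_ge0 (p x); have := sqr_ge0 (q x); nra.
Qed.

Lemma rL2_cst a b r : rL2 a b (cst r).
Proof. by split; [exact: measurable_cst|exact: (integrable_cst_itv a b (r ^+ 2))]. Qed.

Lemma rL2_integrable a b p : rL2 a b p -> mu.-integrable `]a, b[ (EFin \o p).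
Proof.
move=> hp; have := rL2M hp (rL2_cst a b 1).
by apply: eq_integrable => // x _ /=; rewrite mulr1.
Qed.

Lemma rL2_lin a b r p q : rL2 a b p -> rL2 a b q ->
  rL2 a b (fun x => r * p x + q x).
Proof.
move=> hp hq; split.
  by apply: measurable_funD; [apply: measurable_funM => //; exact: hp.1|exact: hq.1].
have : mu.-integrable `]a, b[ (EFin \o (fun x => r ^+ 2 * p x ^+ 2 +
    ((2 * r) * (p x * q x) + q x ^+ 2))).
  apply: integrableD_real => //; first by apply: integrableZ_real => //; exact: hp.2.
  apply: integrableD_real => //; last exact: hq.2.
  by apply: integrableZ_real => //; exact: rL2M.
by apply: eq_integrable => // x _ /=; congr EFin; ring.
Qed.

Lemma L2P a b f : L2 a b f <->
  rL2 a b (fun x => complex.Re (f x)) /\ rL2 a b (fun x => complex.Im (f x)).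
Proof.
have normE x : Normc.normc (f x) ^+ 2 = complex.Re (f x) ^+ 2 + complex.Im (f x) ^+ 2.
  by case: (f x) => y z /=; rewrite sqr_sqrtr// addr_ge0// sqr_ge0.
split=> [[mr mi ifn]|[[mr ir] [mi ii]]].
  split; split=> //.
  - apply: (le_integrable _ _ _ ifn) => //.
      by apply/measurable_EFinP; exact: measurable_funX.
    move=> x _; rewrite /= lee_fin normE !ger0_norm ?addr_ge0 ?sqr_ge0//.
    by rewrite lerDl sqr_ge0.
  - apply: (le_integrable _ _ _ ifn) => //.
      by apply/measurable_EFinP; exact: measurable_funX.
    move=> x _; rewrite /= lee_fin normE !ger0_norm ?addr_ge0 ?sqr_ge0//.
    by rewrite lerDr sqr_ge0.
split=> //; have := integrableD_real (_ : measurable `]a, b[) ir ii.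
move=> /(_ (measurable_itv _)); apply: eq_integrable => // x _ /=.
by rewrite normE.
Qed.

Lemma ReZD r (z w : R[i]) :
  complex.Re (r%:C * z + w) = r * complex.Re z + complex.Re w.
Proof. by case: z w => [x y] [x' y'] /=; rewrite mul0r subr0. Qed.

Lemma ImZD r (z w : R[i]) :
  complex.Im (r%:C * z + w) = r * complex.Im z + complex.Im w.
Proof. by case: z w => [x y] [x' y'] /=; rewrite mul0r addr0. Qed.

Lemma L2_subspace a b : real_subspace (L2 a b).
Proof.
split.
  by apply/L2P; split; exact: (rL2_cst a b 0).
move=> r f g /L2P[fr fi] /L2P[gr gi]; apply/L2P; split.
  rewrite (_ : (fun _ => _) = (fun x => r * complex.Re (f x) + complex.Re (g x))).
    exact: rL2_lin.
  by apply/funext => x; rewrite -ReZD.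
rewrite (_ : (fun _ => _) = (fun x => r * complex.Im (f x) + complex.Im (g x))).
  exact: rL2_lin.
by apply/funext => x; rewrite -ImZD.
Qed.

(** The real part of the Hermitian product is a real inner product with the same
    norm, and energy estimates only see real parts. *)
Definition dotr a b f g : R := complex.Re (L2dot a b f g).
Arguments dotr : simpl never.

Lemma dotrE a b f g : dotr a b f g = \int[mu]_(x in `]a, b[)
  (complex.Re (f x) * complex.Re (g x) + complex.Im (f x) * complex.Im (g x)).
Proof.
rewrite /dotr/=; apply: eq_Rintegral => x _.
by case: (f x) (g x) => [y z] [y' z'] /=; rewrite mulrN opprK.
Qed.

Lemma dotr_integrable a b f g : L2 a b f -> L2 a b g -> mu.-integrable `]a, b[
  (EFin \o (fun x => complex.Re (f x) * complex.Re (g x) +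
                     complex.Im (f x) * complex.Im (g x))).
Proof.
move=> /L2P[fr fi] /L2P[gr gi].
by apply: integrableD_real => //; exact: rL2M.
Qed.

Lemma dotr_semi_inner a b : semi_inner (L2 a b) (dotr a b).
Proof.
split=> [r f g h Lf Lg Lh|f g _ _|f _].
- rewrite !dotrE -RintegralZl//; last exact: dotr_integrable.
  rewrite -RintegralD//; [|by apply: integrableZ_real => //; exact: dotr_integrable
                          |exact: dotr_integrable].
  apply: eq_Rintegral => x _.
  have -> : (r%:C *: f + g) x = r%:C * f x + g x by [].
  by rewrite ReZD ImZD; ring.
- by rewrite !dotrE; apply: eq_Rintegral => x _; congr (_ + _); rewrite mulrC.
- by rewrite dotrE; apply: Rintegral_ge0 => x _; rewrite addr_ge0// -expr2 sqr_ge0.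
Qed.

Definition ae_eqon a b f g := {ae mu, forall x, x \in `]a, b[ -> f x = g x}.

Lemma ae_eqon_lin a b (r : R) f f' g g' : ae_eqon a b f f' -> ae_eqon a b g g' ->
  ae_eqon a b (r%:C *: f + g) (r%:C *: f' + g').
Proof.
apply: ae_filterS2 => x H1 H2 xab.
by rewrite /GRing.scale/= /GRing.add/= H1// H2.
Qed.

Lemma dotr_null a b f g : L2 a b f -> L2 a b g -> ae_eqon a b f g ->
  dotr a b (f - g) (f - g) = 0.
Proof.
move=> Lf Lg fg; rewrite dotrE.
have Lfg := subspaceB (L2_subspace a b) Lf Lg.
rewrite /Rintegral (ae_eq_integral (cst 0%E))//; first by rewrite integral0.
  exact: measurable_int (dotr_integrable Lfg Lfg).
move: fg; apply: ae_filterS => x H xab /=.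
have -> : (f - g) x = f x - g x by [].
by rewrite H// subrr /= mulr0 addr0.
Qed.

(** Almost everywhere equal functions differ by a null vector of the form. *)
Lemma dotr_ael a b f f' g : L2 a b f -> L2 a b f' -> L2 a b g ->
  ae_eqon a b f f' -> dotr a b f g = dotr a b f' g.
Proof.
move=> Lf Lf' Lg ff'.
apply: (semi_inner_null (L2_subspace a b) (dotr_semi_inner a b) Lf Lf') => //.
exact: dotr_null.
Qed.

End ComplexL2.
Arguments dotr : simpl never.

(** * Weak derivatives of complex-valued functions *)

Section ComplexWeakDerivative.
Context {R : realType}.
Notation mu := (@lebesgue_measure R).
Local Open Scope complex_scope.
Implicit Types (a b c r x : R) (f g u v : R -> R[i]) (p q : R -> R) (k : nat).

(** Test functions are real, so weak differentiation acts separately on real and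
    imaginary parts. *)
Definition rwderiv a b k p q := forall phi, test_function a b phi ->
  \int[mu]_(x in `]a, b[) (p x * derive1n k phi x) =
  (-1) ^+ k * \int[mu]_(x in `]a, b[) (q x * phi x).

Lemma is_wderivP a b k u g : is_wderiv a b k u g <-> [/\ L2 a b g,
  rwderiv a b k (fun x => complex.Re (u x)) (fun x => complex.Re (g x)) &
  rwderiv a b k (fun x => complex.Im (u x)) (fun x => complex.Im (g x))].
Proof.
have ReM f p : complex.Re (Cintegral a b (fun x => f x * (p x)%:C)) =
    \int[mu]_(x in `]a, b[) (complex.Re (f x) * p x).
  by apply: eq_Rintegral => x _; case: (f x) => y z /=; rewrite mulr0 subr0.
have ImM f p : complex.Im (Cintegral a b (fun x => f x * (p x)%:C)) =
    \int[mu]_(x in `]a, b[) (complex.Im (f x) * p x).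
  by apply: eq_Rintegral => x _; case: (f x) => y z /=; rewrite mulr0 add0r.
have signE : ((-1) ^+ k : R[i]) = ((-1) ^+ k : R)%:C by rewrite rmorphXn/= rmorphN1.
split=> [[Lg H]|[Lg Hr Hi]].
  split=> // phi tphi; have := H _ tphi; rewrite signE => E.
    by rewrite -[LHS]ReM -[X in _ * X]ReM E -[X in complex.Re X]addr0 ReZD addr0.
  by rewrite -[LHS]ImM -[X in _ * X]ImM E -[X in complex.Im X]addr0 ImZD addr0.
split=> // phi tphi; apply/eqP; rewrite eq_complex signE.
rewrite -[X in complex.Re X == complex.Re _]/(Cintegral _ _ _) ReM.
rewrite -[X in _ == complex.Re X]addr0 ReZD ImM -[X in _ == complex.Im X]addr0 ImZD.
by rewrite ReM ImM Hr// Hi// !addr0 !eqxx.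
Qed.

Lemma test_function_derive1n a b k phi :
  test_function a b phi -> test_function a b (derive1n k phi).
Proof.
by move=> tphi; elim: k => [//|k ih]; rewrite derive1nS; exact: test_function_derive.
Qed.

(** The difference of two weak derivatives is orthogonal to all test functions. *)
Lemma rwderiv_unique a b k p q q' : a < b ->
  mu.-integrable `]a, b[ (EFin \o q) -> mu.-integrable `]a, b[ (EFin \o q') ->
  rwderiv a b k p q -> rwderiv a b k p q' ->
  {ae mu, forall x, x \in `]a, b[ -> q x = q' x}.
Proof.
move=> ab iq iq' pq pq'.
have : {ae mu, forall x, x \in `]a, b[ -> q x - q' x = 0}.
  apply: ae0_of_test => //; first exact: integrableB_real.
  move=> phi tphi; under eq_Rintegral do rewrite mulrBl.
  rewrite RintegralB//; [|exact: integrableM_test..].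
  apply/eqP; rewrite subr_eq0; apply/eqP.
  have /mulrI : ((-1) ^+ k : R) \is a GRing.unit by rewrite unitrX// unitrN1.
  by apply; rewrite -pq// -pq'.
by apply: ae_filterS => x H /H/eqP; rewrite subr_eq0 => /eqP.
Qed.

Lemma rwderiv_lin a b k r p q p' q' :
  mu.-integrable `]a, b[ (EFin \o p) -> mu.-integrable `]a, b[ (EFin \o q) ->
  mu.-integrable `]a, b[ (EFin \o p') -> mu.-integrable `]a, b[ (EFin \o q') ->
  rwderiv a b k p q -> rwderiv a b k p' q' ->
  rwderiv a b k (fun x => r * p x + p' x) (fun x => r * q x + q' x).
Proof.
move=> ip iq ip' iq' pq pq' phi tphi.
have tphik := test_function_derive1n k tphi.
under eq_Rintegral do rewrite mulrDl -mulrA.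
under [in RHS]eq_Rintegral do rewrite mulrDl -mulrA.
rewrite !RintegralD//; try exact: integrableM_test;
  try by apply: integrableZ_real => //; exact: integrableM_test.
rewrite !RintegralZl//; try exact: integrableM_test.
by rewrite pq// pq'//; ring.
Qed.

Lemma is_wderiv_unique a b k u g g' : a < b ->
  is_wderiv a b k u g -> is_wderiv a b k u g' -> ae_eqon a b g g'.
Proof.
move=> ab /is_wderivP[/L2P[gr gi] ugr ugi] /is_wderivP[/L2P[gr' gi'] ugr' ugi'].
have hr := rwderiv_unique ab (rL2_integrable gr) (rL2_integrable gr') ugr ugr'.
have hi := rwderiv_unique ab (rL2_integrable gi) (rL2_integrable gi') ugi ugi'.
apply: ae_filterS2 hr hi => x Hr Hi xab; apply/eqP.
by rewrite eq_complex Hr// Hi// !eqxx.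
Qed.

Lemma is_wderiv_lin a b k r u v g h : L2 a b u -> L2 a b v ->
  is_wderiv a b k u g -> is_wderiv a b k v h ->
  is_wderiv a b k (r%:C *: u + v) (r%:C *: g + h).
Proof.
move=> Lu Lv /is_wderivP[Lg ugr ugi] /is_wderivP[Lh vhr vhi].
apply/is_wderivP; split; first exact: (L2_subspace a b).2.
- have ReE f f' : (fun x => complex.Re ((r%:C *: f + f') x)) =
      (fun x => r * complex.Re (f x) + complex.Re (f' x)).
    by apply/funext => x; rewrite -ReZD.
  rewrite !ReE; move: Lu Lv Lg Lh => /L2P[? _] /L2P[? _] /L2P[? _] /L2P[? _].
  by apply: rwderiv_lin => //; exact: rL2_integrable.
- have ImE f f' : (fun x => complex.Im ((r%:C *: f + f') x)) =
      (fun x => r * complex.Im (f x) + complex.Im (f' x)).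
    by apply/funext => x; rewrite -ImZD.
  rewrite !ImE; move: Lu Lv Lg Lh => /L2P[_ ?] /L2P[_ ?] /L2P[_ ?] /L2P[_ ?].
  by apply: rwderiv_lin => //; exact: rL2_integrable.
Qed.

(** Derivatives of test functions are test functions. *)
Lemma is_wderiv_derive a b u g1 g2 :
  is_wderiv a b 1 u g1 -> is_wderiv a b 2 u g2 -> is_wderiv a b 1 g1 g2.
Proof.
move=> /is_wderivP[Lg1 r1 i1] /is_wderivP[Lg2 r2 i2].
(* Test the first derivative with [phi'] and the second one with [phi]. *)
have chain p q1 q2 : rwderiv a b 1 p q1 -> rwderiv a b 2 p q2 -> rwderiv a b 1 q1 q2.
  move=> h1 h2 phi tphi; have tphi' := test_function_derive tphi.
  have e1 := h1 _ tphi'; have e2 := h2 _ tphi.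
  move: e1 e2; rewrite !derive1n1 !derive1nS derive1n0 => ->.
  by rewrite expr1 expr2 mulN1r mulrNN mulr1 mul1r mulN1r => <-; rewrite opprK.
by apply/is_wderivP; split => //; [exact: chain r1 r2|exact: chain i1 i2].
Qed.

Lemma is_wderiv_wderiv a b k u : has_wderiv a b k u -> is_wderiv a b k u (wderiv a b k u).
Proof. by move=> [g ug]; apply: (@xgetPex _ 0 [set g | is_wderiv a b k u g]); exists g. Qed.

Lemma wderiv_ae a b k u g : a < b -> is_wderiv a b k u g ->
  ae_eqon a b (wderiv a b k u) g.
Proof.
move=> ab ug; apply: (is_wderiv_unique ab _ ug).
by apply: is_wderiv_wderiv; exists g.
Qed.

Lemma wderiv_L2 a b k u : has_wderiv a b k u -> L2 a b (wderiv a b k u).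
Proof. by move=> /is_wderiv_wderiv[]. Qed.

Definition wdom a b k := [set u | L2 a b u /\ has_wderiv a b k u].

Lemma has_wderiv_lin a b k r u v : L2 a b u -> L2 a b v ->
  has_wderiv a b k u -> has_wderiv a b k v -> has_wderiv a b k (r%:C *: u + v).
Proof.
move=> Lu Lv [g ug] [h vh]; exists (r%:C *: g + h); exact: is_wderiv_lin.
Qed.

(** A chosen representative of the weak derivative cannot be expected to depend
    linearly on [u] at every point; uniqueness gives linearity almost
    everywhere. *)
Lemma wderiv_lin a b k r u v : a < b -> L2 a b u -> L2 a b v ->
  has_wderiv a b k u -> has_wderiv a b k v ->
  ae_eqon a b (wderiv a b k (r%:C *: u + v))
    (r%:C *: wderiv a b k u + wderiv a b k v).
Proof.
move=> ab Lu Lv hu hv; apply: wderiv_ae => //.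
by apply: is_wderiv_lin => //; exact: is_wderiv_wderiv.
Qed.

Lemma is_wderiv0 a b k : is_wderiv a b k 0 0.
Proof.
have I0 p : \int[mu]_(x in `]a, b[) (0 * p x) = 0.
  by under eq_Rintegral do rewrite mul0r; rewrite Rintegral_cst//= mul0r.
apply/is_wderivP; split; first exact: (L2_subspace a b).1.
  by move=> phi _; rewrite !I0 mulr0.
by move=> phi _; rewrite !I0 mulr0.
Qed.

Lemma wdom_subspace a b k : real_subspace (wdom a b k).
Proof.
split; first by split; [exact: (L2_subspace a b).1|exists 0; exact: is_wderiv0].
move=> r u v [Lu hu] [Lv hv]; split; first exact: (L2_subspace a b).2.
exact: has_wderiv_lin.
Qed.

Definition wdotr a b k u v := dotr a b (wderiv a b k u) (wderiv a b k v).

Lemma wdotr_semi_inner a b k : a < b -> semi_inner (wdom a b k) (wdotr a b k).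
Proof.
move=> ab; have [lB sB pB] := @dotr_semi_inner R a b.
split=> [r u v w [Lu hu] [Lv hv] [Lw hw]|u v [Lu hu] [Lv hv]|u [Lu hu]].
- have [[Lu' Lv'] Lw'] := (wderiv_L2 hu, wderiv_L2 hv, wderiv_L2 hw).
  rewrite /wdotr; apply: (etrans _ (lB r _ _ _ Lu' Lv' Lw')); apply: dotr_ael => //.
  + exact: wderiv_L2 (has_wderiv_lin r Lu Lv hu hv).
  + exact: (L2_subspace a b).2.
  + exact: wderiv_lin.
- by apply: sB; exact: wderiv_L2.
- by apply: pB; exact: wderiv_L2.
Qed.

End ComplexWeakDerivative.
Arguments wdotr : simpl never.

(** * Continuous representatives and traces *)

Section Trace.
Context {R : realType}.
Notation mu := (@lebesgue_measure R).
Local Open Scope complex_scope.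
Implicit Types (a b c d r x y : R) (f g u v : R -> R[i]) (p q : R -> R) (k : nat).

Lemma ae_itv_exists c d (P : R -> Prop) : c < d -> {ae mu, forall x, P x} ->
  exists2 y, c < y < d & P y.
Proof.
move=> cd [N [mN N0 PN]]; apply: contrapT => noP.
have sN : `]c, d[ `<=` N.
  move=> y; rewrite /= in_itv/= => cyd; apply: PN => /= Py; apply: noP.
  by exists y.
have : (mu `]c, d[ <= mu N)%E by apply: le_measure; rewrite ?inE.
by rewrite N0 lebesgue_measure_itv/= lte_fin cd -EFinD lee_fin leNgt subr_gt0 cd.
Qed.

(** A nonzero value of the difference would persist on an interval, which has
    positive measure; the end points [a] and [b] are limits of such intervals. *)
Lemma continuous_ae_unique a b p q : a < b ->
  {within `[a, b], continuous p} -> {within `[a, b], continuous q} ->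
  {ae mu, forall x, x \in `]a, b[ -> p x = q x} ->
  forall x, a <= x <= b -> p x = q x.
Proof.
move=> ab cp cq pq x xab; apply/eqP; rewrite -subr_eq0; apply/negPn/negP => h0.
pose h y := p y - q y.
have ch : {within `[a, b], continuous h}.
  by move=> y; apply: continuousB; [exact: cp|exact: cq].
have e0 : 0 < `|h x| by rewrite normr_gt0.
have xab' : `[a, b]%classic x by rewrite /= in_itv.
have /cvgrPdist_lt/(_ _ e0) := (subspace_continuousP _ _).1 ch x xab'.
move=> /nbhs_ballP[d /= d0 Hd].
move: xab => /andP[ax xb].
pose c1 := Num.max a (x - d); pose c2 := Num.min b (x + d).
have c12 : c1 < c2.
  rewrite /c1 /c2 gt_max !lt_min ab/=; apply/and3P; split=> //; lra.
have [y] := ae_itv_exists c12 pq.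
rewrite /c1 /c2 gt_max lt_min => /andP[/andP[ay xdy] /andP[yb yxd]].
rewrite in_itv/= ay yb => /(_ isT) pqy.
have := Hd y; rewrite /ball/= ltr_distlC xdy yxd => /(_ isT).
rewrite /= in_itv/= !ltW// => /(_ isT).
by rewrite /h /from_subspace pqy subrr subr0 ltxx.
Qed.

Lemma is_crepr_trace a b u g x : a < b -> is_crepr a b u g -> a <= x <= b ->
  trace a b u x = g x.
Proof.
move=> ab ug xab; have := @xgetPex _ 0 [set g | is_crepr a b u g] (ex_intro _ _ ug).
rewrite /trace; move: (xget _ _) => h [hr hi uh]; case: ug => gr gi ug.
have hg : ae_eqon a b h g by apply: ae_filterS2 uh ug => y H1 H2 yab; rewrite -H1// H2.
apply/eqP; rewrite eq_complex; apply/andP; split; apply/eqP.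
  apply: (continuous_ae_unique ab hr gr _ xab).
  by apply: ae_filterS hg => y H yab; rewrite H.
apply: (continuous_ae_unique ab hi gi _ xab).
by apply: ae_filterS hg => y H yab; rewrite H.
Qed.

Lemma trace_ae a b u v : ae_eqon a b u v -> trace a b u = trace a b v.
Proof.
move=> uv; rewrite /trace; congr (xget _ _).
apply/seteqP; split=> g [gr gi ug]; split=> //.
  by apply: ae_filterS2 uv ug => y H1 H2 yab; rewrite -H1// H2.
by apply: ae_filterS2 uv ug => y H1 H2 yab; rewrite H1// H2.
Qed.

Lemma within_continuous_lin a b r p q :
  {within `[a, b], continuous p} -> {within `[a, b], continuous q} ->
  {within `[a, b], continuous (fun x => r * p x + q x)}.
Proof.
move=> cp cq x.
apply: (@continuousD _ _ (subspace `[a, b]) (fun x => r * p x) q); last exact: cq.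
apply: (@continuousM _ (subspace `[a, b]) (fun=> r) p); last exact: cp.
exact: cst_continuous.
Qed.

Lemma within_continuous_addl a b r p : {within `[a, b], continuous p} ->
  {within `[a, b], continuous (fun x => r + p x)}.
Proof.
move=> cp x; apply: (@continuousD _ _ (subspace `[a, b]) (fun=> r) p).
  exact: cst_continuous.
exact: cp.
Qed.

Lemma is_crepr_lin a b r u v g h : is_crepr a b u g -> is_crepr a b v h ->
  is_crepr a b (r%:C *: u + v) (r%:C *: g + h).
Proof.
move=> [gr gi ug] [hr hi vh]; split; last exact: ae_eqon_lin.
- have -> : (fun x => complex.Re ((r%:C *: g + h) x)) =
      (fun x => r * complex.Re (g x) + complex.Re (h x)).
    by apply/funext => x; rewrite -ReZD.
  exact: within_continuous_lin.
- have -> : (fun x => complex.Im ((r%:C *: g + h) x)) =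
      (fun x => r * complex.Im (g x) + complex.Im (h x)).
    by apply/funext => x; rewrite -ImZD.
  exact: within_continuous_lin.
Qed.

Lemma trace_lin a b r u v x : a < b -> a <= x <= b ->
  (exists g, is_crepr a b u g) -> (exists h, is_crepr a b v h) ->
  trace a b (r%:C *: u + v) x = r%:C * trace a b u x + trace a b v x.
Proof.
move=> ab xab [g ug] [h vh].
rewrite (is_crepr_trace ab (is_crepr_lin r ug vh) xab).
by rewrite (is_crepr_trace ab ug xab) (is_crepr_trace ab vh xab).
Qed.

Definition sqn (z : R[i]) := complex.Re z ^+ 2 + complex.Im z ^+ 2.

Lemma dotr_sqn a b f : dotr a b f f = \int[mu]_(x in `]a, b[) sqn (f x).
Proof. by rewrite dotrE; apply: eq_Rintegral => x _; rewrite /sqn !expr2. Qed.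

(** One-dimensional Sobolev embedding. The representative is a constant plus the
    primitive of [g], and its Hölder bound is the Cauchy-Schwarz inequality. *)
Lemma wderiv1_crepr a b u g : a < b -> L2 a b u -> is_wderiv a b 1 u g ->
  exists U, is_crepr a b u U /\ forall x y, a <= x <= b -> a <= y <= b ->
    sqn (U y - U x) <= (b - a) * dotr a b g g.
Proof.
move=> ab Lu ug; have Lg : L2 a b g by case: ug.
move: ug => /is_wderivP[_ wr wi].
move: (Lu) (Lg) => /L2P[ur ui] /L2P[gr gi].
have key p q : rL2 a b p -> rL2 a b q -> rwderiv a b 1 p q ->
    exists K, {ae mu, forall x, x \in `]a, b[ -> p x = K + prim a q x}.
  move=> hp hq wpq; apply: weak_derivative_primitive => //; try exact: rL2_integrable.
  by move=> phi tphi; rewrite -[derive1 phi]derive1n1 wpq// expr1 mulN1r.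
have [Kr Hr] := key _ _ ur gr wr.
have [Ki Hi] := key _ _ ui gi wi.
have igr := rL2_integrable gr.
have igi := rL2_integrable gi.
exists (fun x => (Kr + prim a (fun x => complex.Re (g x)) x) +i*
                 (Ki + prim a (fun x => complex.Im (g x)) x)); split.
  split.
  - have := prim_continuous (ltW ab) igr; exact: within_continuous_addl.
  - have := prim_continuous (ltW ab) igi; exact: within_continuous_addl.
  - apply: ae_filterS2 Hr Hi => x H1 H2 xab; apply/eqP.
    by rewrite eq_complex/= -H1// -H2// !eqxx.
move=> x y xab yab; rewrite dotr_sqn /sqn/=.
have shift (K s t : R) : K + t - (K + s) = t - s by ring.
rewrite !shift.
rewrite RintegralD//; [|exact: gr.2|exact: gi.2].
by rewrite mulrDr lerD//; apply: prim_variation => //; [exact: gr.2|exact: gi.2].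
Qed.

End Trace.

(** * Poincaré inequalities *)

Section Poincare.
Context {R : realType}.
Notation mu := (@lebesgue_measure R).
Local Open Scope complex_scope.
Implicit Types (a b c d r x y : R) (f g u v : R -> R[i]) (p q : R -> R) (k : nat).

Lemma sqn_ge0 (z : R[i]) : 0 <= sqn z.
Proof. by rewrite addr_ge0// sqr_ge0. Qed.

Lemma sqnD_le (z w : R[i]) : sqn z <= 2 * (sqn w + sqn (z - w)).
Proof.
case: z w => [x y] [x' y']; rewrite /sqn/=.
by have := sqr_ge0 (2 * x' - x); have := sqr_ge0 (2 * y' - y); nra.
Qed.

Lemma dotr_le_cst a b u (C : R) : a <= b -> 0 <= C -> L2 a b u ->
  {ae mu, forall x, x \in `]a, b[ -> sqn (u x) <= C} ->
  dotr a b u u <= C * (b - a).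
Proof.
move=> ab C0 Lu uC; rewrite -Rintegral_cst_itv// dotr_sqn.
have iu : mu.-integrable `]a, b[ (EFin \o (fun x => sqn (u x))).
  rewrite (_ : (fun x => _) = (fun x => complex.Re (u x) * complex.Re (u x) +
      complex.Im (u x) * complex.Im (u x))); first exact: dotr_integrable.
  by apply/funext => x; rewrite /sqn !expr2.
have ic := integrable_cst_itv a b C.
rewrite /Rintegral fine_le//.
- exact: integrable_fin_num iu.
- exact: integrable_fin_num ic.
- apply: ae_ge0_le_integral => //.
  + by move=> x _; rewrite lee_fin sqn_ge0.
  + exact: measurable_int iu.
Qed.

Lemma trace_variation a b u g x y : a < b -> L2 a b u -> is_wderiv a b 1 u g ->
  a <= x <= b -> a <= y <= b ->
  sqn (trace a b u y) <= 2 * (sqn (trace a b u x) + (b - a) * dotr a b g g).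
Proof.
move=> ab Lu ug xab yab; have [U [uU HU]] := wderiv1_crepr ab Lu ug.
rewrite !(is_crepr_trace ab uU)//.
by rewrite (le_trans (sqnD_le _ (U x)))// ler_pM2l// lerD2l HU.
Qed.

(** Poincaré's inequality without boundary condition: the trace at one point
    controls the mean. *)
Lemma poincare_trace a b u g c : a < b -> L2 a b u -> is_wderiv a b 1 u g ->
  a <= c <= b ->
  dotr a b u u <= 2 * (sqn (trace a b u c) + (b - a) * dotr a b g g) * (b - a).
Proof.
move=> ab Lu ug cab; have [U [uU HU]] := wderiv1_crepr ab Lu ug.
have Lg : L2 a b g by case: ug.
apply: dotr_le_cst => //; first exact: ltW.
  rewrite mulr_ge0// addr_ge0 ?sqn_ge0// mulr_ge0 ?subr_ge0 ?(ltW ab)//.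
  exact: (semi_inner_ge0 (dotr_semi_inner a b) Lg).
case: (uU) => _ _; apply: ae_filterS => x uxU xab; rewrite uxU//.
have xab' : a <= x <= b by move: xab; rewrite in_itv/= => /andP[? ?]; rewrite !ltW.
rewrite -(is_crepr_trace ab uU xab').
exact: trace_variation ug cab xab'.
Qed.

Lemma has_crepr a b u : a < b -> wdom a b 1 u -> exists U, is_crepr a b u U.
Proof.
move=> ab [Lu [g ug]]; have [U [uU _]] := wderiv1_crepr ab Lu ug.
by exists U.
Qed.

Lemma trace0 a b c : a < b -> a <= c <= b -> trace a b (0 : R -> R[i]) c = 0.
Proof.
move=> ab cab; rewrite (@is_crepr_trace _ a b 0 0)//.
by split; [move=> x; exact: cst_continuous|move=> x; exact: cst_continuous|exact: aeW].
Qed.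

Lemma Sobolev_subspace a b m : real_subspace (@Sobolev R a b m).
Proof.
split.
  split; first exact: (L2_subspace a b).1.
  by move=> k _; exact: (wdom_subspace a b k).1.2.
move=> r u v [Lu Hu] [Lv Hv]; split; first exact: (L2_subspace a b).2.
by move=> k km; apply: has_wderiv_lin => //; [exact: Hu|exact: Hv].
Qed.

Lemma Sobolev2_wderiv a b u : Sobolev a b 2 u -> [/\ wdom a b 1 u,
  wdom a b 2 u, wdom a b 1 (wderiv a b 1 u) &
  is_wderiv a b 1 (wderiv a b 1 u) (wderiv a b 2 u)].
Proof.
move=> [Lu Hu]; have h1 := Hu 1%N isT; have h2 := Hu 2%N isT.
have w := is_wderiv_derive (is_wderiv_wderiv h1) (is_wderiv_wderiv h2).
split=> //; split; first exact: wderiv_L2.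
by exists (wderiv a b 2 u).
Qed.

Lemma H2clamped_subspace a b c : a < b -> a <= c <= b ->
  real_subspace (@H2clamped R a b c).
Proof.
move=> ab cab; split.
  split; first exact: (Sobolev_subspace a b 2).1.
    exact: trace0.
  rewrite (@trace_ae _ a b _ 0); first exact: trace0.
  by apply: wderiv_ae => //; exact: is_wderiv0.
move=> r u v [Su tu tu'] [Sv tv tv'].
have [u1 u2 u' _] := Sobolev2_wderiv Su; have [v1 v2 v' _] := Sobolev2_wderiv Sv.
split; first exact: (Sobolev_subspace a b 2).2.
  by rewrite trace_lin// ?tu ?tv ?mulr0 ?addr0//; exact: has_crepr.
have [[Lu hu] [Lv hv]] := (u1, v1).
rewrite (trace_ae (wderiv_lin r ab Lu Lv hu hv)).
by rewrite trace_lin// ?tu' ?tv' ?mulr0 ?addr0//; exact: has_crepr.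
Qed.

(** Both [u] and [u'] vanish at the clamped end [c], so Poincaré's inequality
    applies first to [u'], then to [u]. *)
Lemma H2clamped_wderiv1_le a b c u : a < b -> a <= c <= b -> H2clamped a b c u ->
  wdotr a b 1 u u <= 2 * (b - a) ^+ 2 * wdotr a b 2 u u.
Proof.
move=> ab cab [Su tu tu']; have [_ _ [L1 _] w] := Sobolev2_wderiv Su.
have := poincare_trace ab L1 w cab; rewrite tu' /sqn/= expr0n/= addr0 add0r.
by rewrite /wdotr => /le_trans; apply; rewrite le_eqVlt; apply/orP; left; apply/eqP; ring.
Qed.

Lemma H2clamped_le a b c u : a < b -> a <= c <= b -> H2clamped a b c u ->
  dotr a b u u <= 2 * (b - a) ^+ 2 * wdotr a b 1 u u.
Proof.
move=> ab cab [Su tu tu']; have [[Lu hu] _ _ _] := Sobolev2_wderiv Su.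
have := poincare_trace ab Lu (is_wderiv_wderiv hu) cab.
rewrite tu /sqn/= expr0n/= addr0 add0r.
by rewrite /wdotr => /le_trans; apply; rewrite le_eqVlt; apply/orP; left; apply/eqP; ring.
Qed.

Lemma H2clamped_trace_le a b c x u : a < b -> a <= c <= b -> a <= x <= b ->
  H2clamped a b c u -> sqn (trace a b u x) <= 2 * (b - a) * wdotr a b 1 u u.
Proof.
move=> ab cab xab [Su tu tu']; have [[Lu hu] _ _ _] := Sobolev2_wderiv Su.
have := trace_variation ab Lu (is_wderiv_wderiv hu) cab xab.
by rewrite tu /sqn/= expr0n/= addr0 add0r mulrA.
Qed.

End Poincare.

(** * The phase space *)

Section PhaseSpace.
Context {R : realType}.
Local Open Scope complex_scope.
Variables (l0 l1 l2 l3 rho1 rho2 beta : R).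
Hypotheses (hl01 : l0 < l1) (hl12 : l1 < l2) (hl23 : l2 < l3)
  (hrho1 : 0 < rho1) (hrho2 : 0 < rho2) (hbeta : 0 < beta).
Notation bH := (bH l0 l1 l2 l3).
Notation bL := (bL l0 l1 l2 l3).

Let in00 : l0 <= l0 <= l1. Proof. by rewrite lexx ltW. Qed.
Let in01 : l0 <= l1 <= l1. Proof. by rewrite lexx ltW. Qed.
Let in11 : l1 <= l1 <= l2. Proof. by rewrite lexx ltW. Qed.
Let in12 : l1 <= l2 <= l2. Proof. by rewrite lexx ltW. Qed.
Let in22 : l2 <= l2 <= l3. Proof. by rewrite lexx ltW. Qed.
Let in23 : l2 <= l3 <= l3. Proof. by rewrite lexx ltW. Qed.

(** The real parts of the energy products, and the dissipation form [formQ],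
    written with projections so that they are sums of forms on a product space. *)
Definition formH (p q : triple R) : R := wdotr l0 l1 2 p.1.1 q.1.1 +
  wdotr l1 l2 1 p.1.2 q.1.2 + wdotr l2 l3 2 p.2 q.2.

Definition formL (p q : triple R) : R := dotr l0 l1 p.1.1 q.1.1 +
  dotr l1 l2 p.1.2 q.1.2 + dotr l2 l3 p.2 q.2.

Definition formQ (p q : triple R) : R := rho1 * wdotr l0 l1 1 p.1.1 q.1.1 +
  beta * dotr l1 l2 p.1.2 q.1.2 + rho2 * wdotr l2 l3 1 p.2 q.2.

Lemma Re_add (z w : R[i]) : complex.Re (z + w) = complex.Re z + complex.Re w.
Proof. by case: z w => [? ?] []. Qed.

Lemma Re_opp (z : R[i]) : complex.Re (- z) = - complex.Re z.
Proof. by case: z. Qed.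

Lemma Re_bHdot p q : complex.Re (bHdot l0 l1 l2 l3 p q) = formH p q.
Proof.
by case: p q => [[u v] w] [[u' v'] w']; rewrite -[LHS]/(complex.Re (_ + _ + _)) !Re_add.
Qed.

Lemma Re_bLdot p q : complex.Re (bLdot l0 l1 l2 l3 p q) = formL p q.
Proof.
by case: p q => [[u v] w] [[u' v'] w']; rewrite -[LHS]/(complex.Re (_ + _ + _)) !Re_add.
Qed.

Lemma bH_subspace : real_subspace bH.
Proof.
have sH1 := H2clamped_subspace hl01 in00.
have sH3 := H2clamped_subspace hl23 in23.
split.
  split; [exact: sH1.1|exact: (Sobolev_subspace l1 l2 1).1|exact: sH3.1|..].
    by rewrite !trace0.
  by rewrite !trace0.
move=> r [[u v] w] [[u' v'] w'] [Hu Hv Hw t1 t2] [Hu' Hv' Hw' t1' t2'].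
have crH a b c f : a < b -> H2clamped a b c f -> exists U, is_crepr a b f U.
  by move=> ab [Sf _ _]; have [h _ _ _] := Sobolev2_wderiv Sf; exact: has_crepr.
have crS a b f : a < b -> Sobolev a b 1 f -> exists U, is_crepr a b f U.
  by move=> ab [Lf hf]; apply: has_crepr => //; split => //; exact: hf.
split; [exact: (sH1.2 r _ _ Hu Hu')
       |exact: ((Sobolev_subspace l1 l2 1).2 r _ _ Hv Hv')
       |exact: (sH3.2 r _ _ Hw Hw')|..].
  rewrite !trace_lin ?t1 ?t1'//;
    by [exact: crH Hu|exact: crH Hu'|exact: crS Hv|exact: crS Hv'].
rewrite !trace_lin ?t2 ?t2'//;
  by [exact: crH Hw|exact: crH Hw'|exact: crS Hv|exact: crS Hv'].
Qed.

Lemma bL_subspace : real_subspace bL.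
Proof.
split; first by split; exact: (L2_subspace _ _).1.
move=> r [[u v] w] [[u' v'] w'] [Hu Hv Hw] [Hu' Hv' Hw'].
by split; apply: (L2_subspace _ _).2.
Qed.

Lemma bH_bL : bH `<=` bL.
Proof. by move=> [[u v] w] [[[? _] _ _] [? _] [[? _] _ _] _ _]. Qed.

Lemma bH_wdom u v w : bH (u, v, w) -> [/\ wdom l0 l1 1 u, wdom l0 l1 2 u,
  wdom l1 l2 1 v, wdom l2 l3 1 w & wdom l2 l3 2 w].
Proof.
move=> [[/Sobolev2_wderiv[? ? _ _] _ _] [Lv hv] [/Sobolev2_wderiv[? ? _ _] _ _] _ _].
by split=> //; split=> //; exact: hv.
Qed.

Lemma semi_inner_formL : semi_inner bL formL.
Proof.
apply: semi_innerS (semi_inner_prod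
  (semi_inner_prod (dotr_semi_inner l0 l1) (dotr_semi_inner l1 l2))
  (dotr_semi_inner l2 l3)).
by move=> [[u v] w] [].
Qed.

Lemma semi_inner_formH : semi_inner bH formH.
Proof.
apply: semi_innerS (semi_inner_prod
  (semi_inner_prod (wdotr_semi_inner 2 hl01) (wdotr_semi_inner 1 hl12))
  (wdotr_semi_inner 2 hl23)).
by move=> [[u v] w] /bH_wdom[].
Qed.

Lemma semi_inner_formQ : semi_inner bH formQ.
Proof.
apply: semi_innerS (semi_inner_prod (semi_inner_prod
  (semi_inner_scale (ltW hrho1) (wdotr_semi_inner 1 hl01))
  (semi_inner_scale (ltW hbeta) (dotr_semi_inner l1 l2)))
  (semi_inner_scale (ltW hrho2) (wdotr_semi_inner 1 hl23))).
by move=> [[u v] w] /bH_wdom[? _ [? _] ? _].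
Qed.

(** The whole kinetic energy is dissipated: directly in the wave part, and by
    Poincaré's inequality for the plates. *)
Lemma formL_le_formQ : exists2 c, 0 < c & forall p, bH p -> formL p p <= c * formQ p p.
Proof.
pose a1 := 2 * (l1 - l0) ^+ 2 / rho1; pose a3 := 2 * (l3 - l2) ^+ 2 / rho2.
have a1_ge0 : 0 <= a1 by rewrite divr_ge0 ?(ltW hrho1)// mulr_ge0// sqr_ge0.
have a3_ge0 : 0 <= a3 by rewrite divr_ge0 ?(ltW hrho2)// mulr_ge0// sqr_ge0.
have b_gt0 : 0 < beta^-1 by rewrite invr_gt0.
exists (a1 + beta^-1 + a3); first lra.
move=> [[u v] w] Hp; have [[Hu Hv Hw _ _] [u1 _ [Lv _] w1 _]] := (Hp, bH_wdom Hp).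
have hu := H2clamped_le hl01 in00 Hu; have hw := H2clamped_le hl23 in23 Hw.
have pu := semi_inner_ge0 (wdotr_semi_inner 1 hl01) u1.
have pv := semi_inner_ge0 (dotr_semi_inner l1 l2) Lv.
have pw := semi_inner_ge0 (wdotr_semi_inner 1 hl23) w1.
rewrite /formL/formQ/= !mulrDr; set A := rho1 * _; set Bv := beta * _; set C := rho2 * _.
have A0 : 0 <= A by rewrite mulr_ge0// ltW.
have B0 : 0 <= Bv by rewrite mulr_ge0// ltW.
have C0 : 0 <= C by rewrite mulr_ge0// ltW.
have eu : dotr l0 l1 u u <= a1 * A.
  rewrite (le_trans hu)// /a1 /A le_eqVlt; apply/orP; left; apply/eqP.
  by field; rewrite gt_eqF.
have ew : dotr l2 l3 w w <= a3 * C.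
  rewrite (le_trans hw)// /a3 /C le_eqVlt; apply/orP; left; apply/eqP.
  by field; rewrite gt_eqF.
have ev : dotr l1 l2 v v = beta^-1 * Bv by rewrite /Bv mulKf// gt_eqF.
have b_ge0 := ltW b_gt0.
move: (dotr l0 l1 u u) (dotr l1 l2 v v) (dotr l2 l3 w w) eu ev ew => u0 v0 w0.
move: A Bv C A0 B0 C0 => A Bv C A0 B0 C0 eu -> ew.
have := mulr_ge0 a1_ge0 B0; have := mulr_ge0 a1_ge0 C0.
have := mulr_ge0 a3_ge0 A0; have := mulr_ge0 a3_ge0 B0.
have := mulr_ge0 b_ge0 A0; have := mulr_ge0 b_ge0 C0.
lra.
Qed.

(** Only [v] has no clamped end; its trace at [l1] is that of [u], which is
    controlled by the elastic energy of the first plate. *)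
Lemma formQ_le_formH : exists2 c, 0 < c & forall p, bH p -> formQ p p <= c * formH p p.
Proof.
pose d1 := 2 * (l1 - l0) ^+ 2; pose d3 := 2 * (l3 - l2) ^+ 2.
pose d2 := l2 - l1; pose s1 := 2 * (l1 - l0).
have d1_ge0 : 0 <= d1 by rewrite mulr_ge0// sqr_ge0.
have d3_ge0 : 0 <= d3 by rewrite mulr_ge0// sqr_ge0.
have d2_gt0 : 0 < d2 by rewrite subr_gt0.
have s1_gt0 : 0 < s1 by rewrite mulr_gt0// subr_gt0.
pose c := rho1 * d1 + beta * (2 * (s1 * d1) * d2) + beta * (2 * d2 ^+ 2) + rho2 * d3.
have ca : 0 <= rho1 * d1 by rewrite mulr_ge0// ltW.
have cb : 0 <= beta * (2 * (s1 * d1) * d2).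
  by rewrite mulr_ge0 ?(ltW hbeta)// mulr_ge0 ?(ltW d2_gt0)// mulr_ge0// mulr_ge0// ltW.
have cc : 0 < beta * (2 * d2 ^+ 2) by rewrite mulr_gt0// mulr_gt0// exprn_gt0.
have cd : 0 <= rho2 * d3 by rewrite mulr_ge0// ltW.
exists c; first by rewrite /c; lra.
move=> [[u v] w] Hp; have [[Hu Hv Hw t1 _] [u1 u2 [Lv hv] w1 w2]] := (Hp, bH_wdom Hp).
have hu := H2clamped_wderiv1_le hl01 in00 Hu.
have hw := H2clamped_wderiv1_le hl23 in23 Hw.
have htr := H2clamped_trace_le hl01 in00 in01 Hu.
have hv' := poincare_trace hl12 Lv (is_wderiv_wderiv hv) in11.
rewrite -t1 -/(wdotr l1 l2 1 v v) -/d2 in hv'.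
rewrite -/d1 in hu; rewrite -/d3 in hw; rewrite -/s1 in htr.
have pu := semi_inner_ge0 (wdotr_semi_inner 2 hl01) u2.
have pv := semi_inner_ge0 (wdotr_semi_inner 1 hl12) (conj Lv hv).
have pw := semi_inner_ge0 (wdotr_semi_inner 2 hl23) w2.
rewrite /formH/formQ/=.
move: (wdotr l0 l1 2 u u) (wdotr l1 l2 1 v v) (wdotr l2 l3 2 w w) hu hw hv' pu pv pw.
move=> A Bv C hu hw hv' pu pv pw.
have e1 : rho1 * wdotr l0 l1 1 u u <= rho1 * d1 * A by rewrite -mulrA ler_pM2l.
have e3 : rho2 * wdotr l2 l3 1 w w <= rho2 * d3 * C by rewrite -mulrA ler_pM2l.
have e2 : beta * dotr l1 l2 v v <=
    beta * (2 * (s1 * d1) * d2) * A + beta * (2 * d2 ^+ 2) * Bv.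
  have htr' : sqn (trace l0 l1 u l1) * d2 <= s1 * (d1 * A) * d2.
    by rewrite ler_pM2r// (le_trans htr)// ler_pM2l.
  have hv2 : dotr l1 l2 v v <= 2 * (s1 * d1) * d2 * A + 2 * d2 ^+ 2 * Bv.
    by rewrite (le_trans hv')//; move: (sqn _) htr' => z htr'; lra.
  apply: le_trans (_ : beta * (2 * (s1 * d1) * d2 * A + 2 * d2 ^+ 2 * Bv) <= _).
    by rewrite ler_pM2l.
  by rewrite mulrDr !mulrA.
have m1 := mulr_ge0 ca pv; have m2 := mulr_ge0 ca pw.
have m3 := mulr_ge0 cb pv; have m4 := mulr_ge0 cb pw.
have m5 := mulr_ge0 (ltW cc) pu; have m6 := mulr_ge0 (ltW cc) pw.
have m7 := mulr_ge0 cd pu; have m8 := mulr_ge0 cd pv.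
rewrite /c; lra.
Qed.

End PhaseSpace.

(** * Dissipation and exponential stability *)

Section Dissipation.
Context {R : realType}.
Local Open Scope complex_scope.
Variables (l0 l1 l2 l3 rho1 rho2 beta : R).
Hypotheses (hl01 : l0 < l1) (hl12 : l1 < l2) (hl23 : l2 < l3).
Notation bH := (bH l0 l1 l2 l3).
Notation formH := (formH l0 l1 l2 l3).
Notation formL := (formL l0 l1 l2 l3).
Notation formQ := (formQ l0 l1 l2 l3 rho1 rho2 beta).
Notation domA := (domA l0 l1 l2 l3 rho1 rho2 beta).
Notation opA := (opA l0 l1 l2 l3 rho1 rho2 beta).

Lemma Re_cHdot (U W : state R) :
  complex.Re (cHdot l0 l1 l2 l3 U W) = formH U.1 W.1 + formL U.2 W.2.
Proof. by rewrite Re_add Re_bHdot Re_bLdot. Qed.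

Lemma Re_forma (U W : state R) :
  complex.Re (forma l0 l1 l2 l3 rho1 rho2 beta U W) =
  formH U.2 W.1 - formH U.1 W.2 - formQ U.2 W.2.
Proof.
case: U W => [[[u1 v1] w1] [[u2 v2] w2]] [[[u1' v1'] w1'] [[u2' v2'] w2']].
have ReZ (r : R) (z : R[i]) : complex.Re (r%:C * z) = r * complex.Re z.
  by rewrite -[_ * z]addr0 ReZD addr0.
rewrite /forma !(@Re_add R) !(@Re_opp R) !ReZ.
have regroup (a b c d e f g h i : R) :
  a + b + c - d - e - f - g - h - i = a + b + c - (d + g + h) - (e + f + i) by ring.
exact: regroup.
Qed.

Lemma opA_fst U : (opA U).1 = U.2.
Proof. by case: U => [[[? ?] ?] [[? ?] ?]]. Qed.

(** Testing with [U] itself, the elastic terms cancel by symmetry. *)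
Lemma domA_dissipation U : domA U -> formH (opA U).1 U.1 + formL (opA U).2 U.2 =
  - formQ U.2 U.2.
Proof.
move=> [H1 H2 _ tU]; have := congr1 (@complex.Re R) (tU U H1 H2).
rewrite Re_cHdot Re_forma => ->.
by rewrite (semi_innerC (semi_inner_formH hl01 hl12 hl23) H2 H1) subrr add0r.
Qed.

(** Testing with [(0, U.1)] selects the second component of [opA U]. *)
Lemma domA_multiplier U : domA U -> formL (opA U).2 U.1 =
  - formH U.1 U.1 - formQ U.2 U.1.
Proof.
move=> [H1 H2 _ tU]; have sH := bH_subspace hl01 hl12 hl23.
have := congr1 (@complex.Re R) (tU (0, U.1) sH.1 H1).
rewrite Re_cHdot Re_forma opA_fst /=.
by rewrite (semi_inner0r sH (semi_inner_formH hl01 hl12 hl23) H2) !add0r.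
Qed.

End Dissipation.

Theorem theorem4p1 (R : realType) (l0 l1 l2 l3 rho1 rho2 beta : R)
    (hl01 : l0 < l1) (hl12 : l1 < l2) (hl23 : l2 < l3)
    (hrho1 : 0 < rho1) (hrho2 : 0 < rho2) (hbeta : 0 < beta)
    (S : R -> state R -> state R)
    (hS : C0_contraction_semigroup (cH l0 l1 l2 l3) (cHnorm l0 l1 l2 l3) S)
    (hA : is_generator (cH l0 l1 l2 l3) (cHnorm l0 l1 l2 l3) S
            (domA l0 l1 l2 l3 rho1 rho2 beta)
            (opA l0 l1 l2 l3 rho1 rho2 beta)) :
  exists C alpha : R, 0 < C /\ 0 < alpha /\
    forall U0 : state R, domA l0 l1 l2 l3 rho1 rho2 beta U0 ->
    forall t : R, 0 <= t ->
      energy l0 l1 l2 l3 (S t U0) <=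
        C * expR (- (alpha * t)) * energy l0 l1 l2 l3 (S 0 U0).
Proof.
pose B (U W : state R) :=
  formH l0 l1 l2 l3 U.1 W.1 + formL l0 l1 l2 l3 U.2 W.2.
have normE : cHnorm l0 l1 l2 l3 = (fun U => Num.sqrt (B U U)).
  by apply/funext => U; rewrite /cHnorm Re_cHdot.
rewrite normE in hS hA.
have sL := bL_subspace l0 l1 l2 l3.
have hH := semi_inner_formH hl01 hl12 hl23.
have hL := semi_inner_formL l0 l1 l2 l3.
have [c1 c1_gt0 LQ] := formL_le_formQ hl01 hl23 hrho1 hrho2 hbeta.
have [c2 c2_gt0 QH] := formQ_le_formH hl01 hl12 hl23 hrho1 hrho2 hbeta.
have [|alpha alpha_gt0 decay] := damped_exponential_decay
  (bH_subspace hl01 hl12 hl23) sL (@bH_bL _ l0 l1 l2 l3) hH hL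
  (semi_inner_formQ hl01 hl23 hrho1 hrho2 hbeta)
  c1_gt0 c2_gt0 LQ QH hS hA.
  move=> U DU; split; [by case: DU|exact: opA_fst|exact: domA_dissipation|].
  exact: domA_multiplier.
have DX U : domA l0 l1 l2 l3 rho1 rho2 beta U -> cH l0 l1 l2 l3 U.
  by move: hA.1 => -> [].
exists 3, alpha; split=> //; split=> // U0 DU0 t t0.
have B0 s : 0 <= s -> 0 <= B (S s U0) (S s U0).
  move=> s0; have [H1 H2] := sg_stable hS s0 (DX _ DU0).
  by rewrite addr_ge0 ?(semi_inner_ge0 hH H1) ?(semi_inner_ge0 hL H2).
rewrite /energy normE !sqr_sqrtr ?B0// mulrCA ler_pM2l ?invr_gt0//.
exact: decay.
Qed.
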